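(* For every $m\in\mathbb N$, the $m$-stage Hamming Distance Recoverable Robust 3-Satisfiability problem with a linear number of $xor$-dependencies is in $\Sigma^p_{2m+1}$, and the $m$-stage Hamming Distance Recoverable Robust 3-Satisfiability problem with $\Gamma$-set scenarios is in $\Sigma^p_{2m+1}$.
   Context: Hamming Distance Recoverable Robust version $P^{HDRR}$ of a problem $P$: given a base scenario $\sigma_0$ (an instance of $P$), a set $\mathsf S$ of recovery scenarios (instances of $P$, obtained by activating/deactivating elements) and an integer $\kappa$, decide whether there is a solution $s_0$ of $\sigma_0$ such that for every $\sigma\in\mathsf S$ there is a solution $s_\sigma$ of $\sigma$ with $|s_0\triangle s_\sigma|\le\kappa$. For 3-Satisfiability, scenarios are sets of active literals, solutions are sets of literals set to true satisfying the clauses restricted to the active literals. The $m$-stage version is defined inductively: $P^{0\text{-}HDRR}=P$, $P^{1\text{-}HDRR}=P^{HDRR}$, and $P^{m\text{-}HDRR}=(P^{(m-1)\text{-}HDRR})^{HDRR}$ for $m>1$; equivalently, there are scenario sets $\mathsf S_1,\dots,\mathsf S_m$ and one asks for a base solution $s_0$ such that for every $\sigma_1\in\mathsf S_1$ there is a solution $s_1$ of $\sigma_1$ within Hamming distance $\kappa$ of $s_0$ such that for every $\sigma_2\in\mathsf S_2$ there is $s_2$ within distance $\kappa$ of $s_1$, and so on up to stage $m$. $xor$-dependency scenarios: a scenario set encoded by $(E',\{(E_{1,1},E_{1,2}),\dots,(E_{n,1},E_{n,2})\})$ (pairwise disjoint sets) consists of all $E'\cup E_1\cup\dots\cup E_n$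 with $E_i\in\{E_{i,1},E_{i,2}\}$, with $n$ linear in the input size. $\Gamma$-set scenarios: a scenario set encoded by $(E',\{E_1,\dots,E_n\})$ and $\Gamma$ consists of all $E'\cup\bigcup_{E\in\mathcal E}E$ with $\mathcal E\subseteq\{E_1,\dots,E_n\}$, $|\mathcal E|\le\Gamma$. *)

(* Defs.v *)
From mathcomp Require Import all_boot.

Set Implicit Arguments.
Unset Strict Implicit.
Unset Printing Implicit Defensive.

Inductive move := MoveLeft | Stay | MoveRight.

(* [None] is the blank; [inl b] is an input bit; [inr w] is an additional
   tape symbol of the machine. *)
Definition symbol (W : finType) : Type := option (bool + W).

(* A deterministic multi-tape Turing machine: [verdict q = Some b] means that [q] is a halting state with answer [b]. *)
Record machine := Machine {
  tapes : nat;
  extra : finType;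
  state : finType;
  start : state;
  verdict : state -> option bool;
  delta : state -> {ffun 'I_tapes -> symbol extra} ->
          state * ('I_tapes -> symbol extra * move)
}.

(* A two-way infinite tape: the cells to the left of the head, nearest first,
   and the cells from the scanned one rightwards; all other cells are blank. *)
Definition tape (W : finType) : Type := seq (symbol W) * seq (symbol W).

Definition scanned W (t : tape W) : symbol W := head None t.2.

Definition act W (a : symbol W * move) (t : tape W) : tape W :=
  let: (l, r) := (t.1, behead t.2) in
  match a.2 with
  | MoveLeft => (behead l, head None l :: a.1 :: r)
  | Stay => (l, a.1 :: r)
  | MoveRight => (a.1 :: l, r)
  end.

Definition config (M : machine) : Type :=
  state M * ('I_(tapes M) -> tape (extra M)).

Definition step (M : machine) (c : config M) : config M :=
  if verdict c.1 is Some _ then c else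
  let: (q, a) := delta c.1 [ffun i => scanned (c.2 i)] in
  (q, fun i => act (a i) (c.2 i)).

Definition word := seq bool.
Definition language := word -> Prop.

(* The i-th argument is written on the i-th tape; the tapes beyond the last
   argument are blank work tapes. *)
Definition init (M : machine) (xs : seq word) : config M :=
  (start M, fun i : 'I_(tapes M) =>
    ([::], [seq Some (inl b) | b <- nth [::] xs i])).

Definition poly_bound (c d n : nat) : nat := c * n ^ d + c.

Definition ptime_relation (k : nat) (R : seq word -> Prop) : Prop :=
  exists (M : machine) (c d : nat), forall xs : seq word, size xs = k ->
    exists (t : nat) (b : bool),
      [/\ t <= poly_bound c d (sumn [seq size x | x <- xs]),
          verdict (iter t (@step M) (init M xs)).1 = Some b
        & b <-> R xs].

(* [k] alternating quantifiers over words of length at most [B], the outermost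
   one being existential iff [ex]; the values are appended to [xs]. *)
Fixpoint alternation (ex : bool) (k B : nat) (R : seq word -> Prop)
    (xs : seq word) : Prop :=
  if k is k'.+1 then
    if ex then exists2 y : word, size y <= B &
                 alternation false k' B R (rcons xs y)
    else forall y : word, size y <= B -> alternation true k' B R (rcons xs y)
  else R xs.

Definition SigmaP (k : nat) (L : language) : Prop :=
  exists2 R : seq word -> Prop, ptime_relation k.+1 R &
    exists c d : nat, forall x : word,
      L x <-> alternation true k (poly_bound c d (size x)) R [:: x].

Definition symdiff (U : finType) (A B : {set U}) : {set U} :=
  (A :\: B) :|: (B :\: A).

Section HammingRecovery.

Variables (scenario : Type) (U : finType).
Variable sol : scenario -> {set U} -> Prop.
Variable kappa : nat.

(* The scenario sets of the successive recovery stages are listed in order; the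
   Hamming distance is measured between consecutive solutions. *)
Fixpoint recoverable (Ss : seq (scenario -> Prop)) (s : {set U}) : Prop :=
  if Ss is Sc :: Ss' then
    forall sigma, Sc sigma ->
      exists s', [/\ sol sigma s', #|symdiff s s'| <= kappa
                   & recoverable Ss' s']
  else True.

Definition HDRR (sigma0 : scenario) (Ss : seq (scenario -> Prop)) : Prop :=
  exists2 s0, sol sigma0 s0 & recoverable Ss s0.

End HammingRecovery.

(* [(i, true)] is the i-th variable and [(i, false)] its negation. *)
Definition lit (n : nat) : finType := ('I_n * bool)%type.

Definition clause (n : nat) : Type := 3.-tuple (lit n).

(* The instance given by the set [sigma] of active literals keeps the active
   literals of every clause (a clause with none left is unsatisfiable); a
   solution is the set of the active literals that are true under a satisfying
   assignment. *)
Definition sat_solution (n : nat) (cs : seq (clause n))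
    (sigma s : {set lit n}) : Prop :=
  exists2 a : 'I_n -> bool,
    all (fun C : clause n =>
           has (fun l => a l.1 == l.2) [seq l <- C | l \in sigma]) cs &
    s = [set l in sigma | a l.1 == l.2].

Record xor_set (n : nat) := XorSet {
  xor_core : {set lit n};
  xor_pairs : seq ({set lit n} * {set lit n})
}.

Definition xor_wf (n : nat) (X : xor_set n) : bool :=
  pairwise (fun A B : {set lit n} => [disjoint A & B])
    (xor_core X :: flatten [seq [:: p.1; p.2] | p <- xor_pairs X]).

Definition xor_scenario (n : nat) (X : xor_set n) (sigma : {set lit n}) :
    Prop :=
  exists ch : 'I_(size (xor_pairs X)) -> bool,
    sigma = xor_core X :|: \bigcup_(i < size (xor_pairs X))
      let: p := tnth (in_tuple (xor_pairs X)) i in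
      if ch i then p.1 else p.2.

Record gamma_set (n : nat) := GammaSet {
  gamma_core : {set lit n};
  gamma_sets : seq {set lit n};
  gamma_bound : nat
}.

Definition gamma_scenario (n : nat) (G : gamma_set n) (sigma : {set lit n}) :
    Prop :=
  exists Es : {set {set lit n}},
    [/\ {subset Es <= gamma_sets G}, #|Es| <= gamma_bound G
      & sigma = gamma_core G :|: \bigcup_(E in Es) E].

(* [S n] is the type of the compressed scenario sets over [n] variables. *)
Record instance (S : nat -> Type) (m : nat) := Instance {
  nvars : nat;
  clauses : seq (clause nvars);
  base : {set lit nvars};
  kappa : nat;
  stages : m.-tuple (S nvars)
}.

Definition robust_3sat (S : nat -> Type) (m : nat)
    (scen : forall n, S n -> {set lit n} -> Prop) (I : instance S m) : Prop :=
  HDRR (sat_solution (clauses I)) (kappa I) (base I)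
    [seq scen _ X | X <- stages I].

(* Self-delimiting binary encodings.  Sets of literals are bit vectors of
   length 2n, a literal is the bit vector of its singleton, the number of
   variables is unary (the literals being part of the instance), and all other
   numbers are in binary, least significant bit first. *)

Definition enc_list (T : Type) (enc : T -> word) (s : seq T) : word :=
  flatten [seq true :: enc x | x <- s] ++ [:: false].

Fixpoint bits_of_pos (p : BinNums.positive) : word :=
  match p with
  | BinNums.xH => [:: true]
  | BinNums.xO p' => false :: bits_of_pos p'
  | BinNums.xI p' => true :: bits_of_pos p'
  end.

Definition bits_of_nat (k : nat) : word :=
  if bin_of_nat k is BinNums.Npos p then bits_of_pos p else [::].

Definition enc_nat (k : nat) : word := enc_list (fun b => [:: b]) (bits_of_nat k).

Definition enc_set (n : nat) (A : {set lit n}) : word :=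
  [seq (i, b) \in A | i <- enum 'I_n, b <- [:: true; false]].

Definition enc_clause (n : nat) (C : clause n) : word :=
  flatten [seq enc_set [set l] | l <- C].

Definition enc_xor (n : nat) (X : xor_set n) : word :=
  enc_set (xor_core X) ++
  enc_list (fun p => enc_set p.1 ++ enc_set p.2) (xor_pairs X).

Definition enc_gamma (n : nat) (G : gamma_set n) : word :=
  enc_set (gamma_core G) ++
  enc_list (@enc_set n) (gamma_sets G) ++
  enc_nat (gamma_bound G).

Definition enc_instance (S : nat -> Type) (m : nat)
    (encS : forall n, S n -> word) (I : instance S m) : word :=
  nseq (nvars I) true ++ false ::
  enc_list (@enc_clause _) (clauses I) ++
  enc_set (base I) ++
  enc_nat (kappa I) ++
  flatten [seq encS _ X | X <- stages I].

(* [c] is the constant of the linear bound on the number of dependencies, which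
   is automatic when [0 < c] because every dependency is spelled out in [x]. *)
Definition HDRR_3SAT_xor (m c : nat) : language := fun x =>
  exists I : instance xor_set m,
    [/\ x = enc_instance enc_xor I,
        all (@xor_wf _) (stages I),
        all (fun X => size (xor_pairs X) <= c * size x) (stages I)
      & robust_3sat xor_scenario I].

Definition HDRR_3SAT_gamma (m : nat) : language := fun x =>
  exists2 I : instance gamma_set m,
    x = enc_instance enc_gamma I & robust_3sat gamma_scenario I.

(* Main.v *)
(* Membership is witnessed by the game itself: the words y_1, ..., y_{2m+1}
   quantified after the input alternately code an assignment (its i-th bit is the
   value of the i-th variable) and a scenario of the next stage (its j-th bit
   chooses in the j-th pair, resp. selects the j-th set).  Every word codes
   something, so the matrix is the plain conjunction of "the input is an
   encoding", "every solution satisfies the clauses" and "consecutive solutions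
   are within distance kappa".  This matrix is definable from the letters of the
   words by arithmetic, counting and recursion of polynomially bounded values
   over the positions of the input, and everything so definable is computed in
   polynomial time by a machine that keeps these values in unary. *)

Require Import Defs.
From mathcomp Require Import all_boot zify.
From Stdlib Require Import FunctionalExtensionality.

Set Implicit Arguments.
Unset Strict Implicit.
Unset Printing Implicit Defensive.

(** * Stack programs and their compilation *)


(** The class asks for an actual multi-tape machine with an explicit time bound. Hence a small
    language of stack programs with exact costs is compiled to machines, and everything after that
    is a closure property of the functions so computed. The same obstacle concerns [kappa] and the
    bound of a Gamma-set, which the input gives in binary: they are read truncated at the length of
    the input, and they are only compared with counts small enough for the truncation not to matter.
    The two kinds of scenario sets differ only in layout and decoding, so the game is analysed once,
    over an abstract interface. Moves no longer than the input suffice, because an assignment and a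
    choice of sets never exceed the encoding in length. *)

Definition upd (A : Type) (s : nat -> A) (r : nat) (w : A) : nat -> A :=
  fun i => if i == r then w else s i.

Lemma updE (A : Type) (s : nat -> A) r w i :
  upd s r w i = if i == r then w else s i.
Proof. by []. Qed.

Definition store := nat -> word.

Inductive cmd :=
  | Push of nat & bool
  | Pop of nat
  | Seq of cmd & cmd
  | If of nat & cmd & cmd
  | While of nat & cmd.

(* [If r c1 c0] does nothing when the stack [r] is empty; the costs are the
   numbers of machine steps taken by the compiled commands. *)
Inductive exec : cmd -> store -> nat -> store -> Prop :=
  | exec_push s r b : exec (Push r b) s 2 (upd s r (b :: s r))
  | exec_pop s r : exec (Pop r) s 1 (upd s r (behead (s r)))
  | exec_seq c1 c2 s s1 s2 t1 t2 :
      exec c1 s t1 s1 -> exec c2 s1 t2 s2 -> exec (Seq c1 c2) s (t1 + t2) s2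
  | exec_if r c1 c0 b w s s' t : s r = b :: w ->
      exec (if b then c1 else c0) s t s' -> exec (If r c1 c0) s t.+1 s'
  | exec_if_nil r c1 c0 s : s r = [::] -> exec (If r c1 c0) s 1 s
  | exec_while r c b w s s1 s2 t1 t2 : s r = b :: w ->
      exec c s t1 s1 -> exec (While r c) s1 t2 s2 ->
      exec (While r c) s (t1 + t2).+1 s2
  | exec_while_nil r c s : s r = [::] -> exec (While r c) s 1 s.

(** * Tapes as stacks, and the control of a stack program *)

Section Tapes.

Notation tp := (tape void).
Notation sym := (symbol void).

(** Lists for the same infinite tape may differ by trailing blanks, which [act] leaves behind when a
    letter is erased or a blank is rewritten past the end; hence the comparison cell by cell. *)
Definition teq (t t' : tp) : Prop :=
  nth None t.1 =1 nth None t'.1 /\ nth None t.2 =1 nth None t'.2.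

(** A stack lies from the head rightwards with its top under the head and blanks elsewhere: a push
    moves left and writes, a pop erases and moves right. *)
Definition word_tape (w : word) : tp := ([::], [seq Some (inl b) | b <- w]).

Lemma teq_trans t1 t2 t3 : teq t1 t2 -> teq t2 t3 -> teq t1 t3.
Proof. by move=> [h1 h2] [h3 h4]; split=> j; rewrite ?h1 ?h2. Qed.

Lemma scanned_teq t t' : teq t t' -> scanned t = scanned t'.
Proof. by move=> [_ /(_ 0)]; rewrite !nth0. Qed.

Lemma nth_behead_cons (T : Type) (a d : T) s j :
  nth d (a :: behead s) j = if j is j'.+1 then nth d s j'.+1 else a.
Proof. by case: j => //= j; rewrite nth_behead. Qed.

Lemma act_teq a t t' : teq t t' -> teq (act a t) (act a t').
Proof.
move=> [h1 h2]; rewrite /act; case: a => a [] /=; split=> j //=.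

- by rewrite !nth_behead.
- by case: j => [|[|j]] /=; rewrite ?nth_behead ?h1 ?h2 -?nth0 ?h1.
- by case: j => [|j] /=; rewrite ?nth_behead.
- by case: j => [|j] /=; rewrite ?nth_behead.
- by rewrite !nth_behead.
Qed.

Lemma act_stay t : teq (act (scanned t, Stay) t) t.
Proof.
by split=> j //=; rewrite nth_behead_cons; case: j.
Qed.

Lemma act_pop w : teq (act (None, MoveRight) (word_tape w)) (word_tape (behead w)).
Proof. split=> j /=; first by case: j => [|[]].
by rewrite /word_tape /=; case: w. Qed.

Lemma act_push w b (t := word_tape w) :
  teq (act (Some (inl b), Stay) (act (scanned t, MoveLeft) t))
      (word_tape (b :: w)).
Proof. by split=> //= -[|j] //=; rewrite /t; case: w {t} => //; case: j => [|[]]. Qed.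

Lemma scanned_word w :
  scanned (word_tape w) = if w is b :: _ then Some (inl b) else None.
Proof. by case: w. Qed.

(* The tape on which the control reads and acts, and the transition as a
   function of the scanned symbol; [None] is the exit. *)
Definition trans (A : Type) : Type := nat * (sym -> option A * (sym * move)).

Definition fire (A : Type) (tr : trans A) (T : nat -> tp) :
    option A * (nat -> tp) :=
  let o := tr.2 (scanned (T tr.1)) in (o.1, upd T tr.1 (act o.2 (T tr.1))).

Inductive run (A : Type) (nx : A -> trans A) :
    A -> (nat -> tp) -> nat -> (nat -> tp) -> Prop :=
  | run_exit p T T' : fire (nx p) T = (None, T') -> run nx p T 1 T'
  | run_step p q T T1 T' t : fire (nx p) T = (Some q, T1) ->
      run nx q T1 t T' -> run nx p T t.+1 T'.

Definition lift (A B : Type) (k : option A -> option B) (tr : trans A) :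
    trans B :=
  (tr.1, fun x => let o := tr.2 x in (k o.1, o.2)).

(** Embeds the run of a subcommand into the control of the enclosing command. The map [k] sends the
    exit either to the outer exit or to a state where execution goes on; these are the two cases of
    the conclusion. *)
Lemma run_lift (A B : Type) (nxA : A -> trans A) (nxB : B -> trans B)
    (j : A -> B) (k : option A -> option B) p T t T' :
  (forall p, nxB (j p) = lift k (nxA p)) -> (forall q, k (Some q) = Some (j q)) ->
  run nxA p T t T' ->
  match k None with
  | None => run nxB (j p) T t T'
  | Some q => forall t2 T2, run nxB q T' t2 T2 -> run nxB (j p) T (t + t2) T2
  end.
Proof.
move=> hnx hk; elim=> {p T t T'} [p T T'|p q T T1 T' t].
  rewrite /fire => -[e1 e2]; case ek: (k None) => [q|].
    move=> t2 T2 r2; rewrite add1n; apply: run_step r2.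
    by rewrite /fire hnx /lift /= e1 e2 ek.
  by apply: run_exit; rewrite /fire hnx /lift /= e1 e2 ek.
rewrite /fire => -[e1 e2] _; case: (k None) => [q'|] IH => [t2 T2 r2|].
  by apply: run_step (IH _ _ r2); rewrite /fire hnx /lift /= e1 e2 hk.
by apply: run_step IH; rewrite /fire hnx /lift /= e1 e2 hk.
Qed.

(** A push takes two machine steps, hence two positions; [None] is the test of a conditional or of a
    loop. *)
Fixpoint pos (c : cmd) : finType :=
  match c with
  | Push _ _ => bool
  | Pop _ => unit
  | Seq a b => (pos a + pos b)%type
  | If _ a b => option (pos a + pos b)
  | While _ a => option (pos a)
  end.

Fixpoint entry (c : cmd) : pos c :=
  match c with
  | Push _ _ => false
  | Pop _ => tt
  | Seq a b => inl (entry a)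
  | If _ a b => None
  | While _ a => None
  end.

(** In a loop the body is lifted along [Some], so its exit [None] becomes the position [None] of the
    loop, that is, its test. *)
Fixpoint nxt (c : cmd) : pos c -> trans (pos c) :=
  match c return pos c -> trans (pos c) with
  | Push r b => fun p : bool =>
      (r, fun x => if p then (None, (Some (inl b), Stay))
                   else (Some true, (x, MoveLeft)))
  | Pop r => fun _ => (r, fun _ => (None, (None, MoveRight)))
  | Seq a b => fun p : pos a + pos b =>
      match p with
      | inl p => lift (fun q => Some (if q is Some q then inl q
                                      else inr (entry b))) (nxt p)
      | inr p => lift (omap inr) (nxt p)
      end
  | If r a b => fun p : option (pos a + pos b) =>
      match p with
      | None => (r, fun x =>
          (match x with
           | Some (inl true) => Some (Some (inl (entry a)))
           | Some (inl false) => Some (Some (inr (entry b)))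
           | _ => None
           end, (x, Stay)))
      | Some (inl p) => lift (omap (fun q => Some (inl q))) (nxt p)
      | Some (inr p) => lift (omap (fun q => Some (inr q))) (nxt p)
      end
  | While r a => fun p : option (pos a) =>
      match p with
      | None => (r, fun x => (if x is Some _ then Some (Some (entry a)) else None,
                              (x, Stay)))
      | Some p => lift (@Some _) (nxt p)
      end
  end.

Definition rep (T : nat -> tp) (s : store) : Prop :=
  forall i, teq (T i) (word_tape (s i)).

Lemma rep_upd T s r t w :
  rep T s -> teq t (word_tape w) -> rep (upd T r t) (upd s r w).
Proof. by move=> h ht i; rewrite /upd; case: eqP. Qed.

Lemma rep_stay T s r : rep T s -> rep (upd T r (act (scanned (T r), Stay) (T r))) s.
Proof.
move=> h i; rewrite /upd; case: eqP => [->|_] //.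
exact: teq_trans (act_stay _) (h r).
Qed.

Lemma exec_run c s t s' : exec c s t s' -> forall T, rep T s ->
  exists2 T', run (@nxt c) (entry c) T t T' & rep T' s'.
Proof.
elim=> {c s t s'}
  [s r b|s r|c1 c2 s s1 s2 t1 t2 _ IH1 _ IH2|r c1 c0 b w s s' t e _ IH|
   r c1 c0 s e|r c b w s s1 s2 t1 t2 e _ IH1 _ IH2|r c s e] T h.
- eexists.
    apply: run_step; first by [].
    by apply: run_exit.
  move=> i; rewrite /= /upd eqxx; case: eqP => _ //.
  apply: (teq_trans _ (act_push _ _)); rewrite (scanned_teq (h r)).
  exact/act_teq/act_teq.
- exists (upd T r (act (None, MoveRight) (T r))); first exact: run_exit.
  by apply: rep_upd => //; apply: (teq_trans (act_teq _ (h r)) (act_pop _)).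
- have [T1 r1 h1] := IH1 _ h; have [T2 r2 h2] := IH2 _ h1.
  exists T2 => //.
  have := run_lift (nxB := @nxt (Seq c1 c2)) (j := inl)
    (k := fun q => Some (if q is Some q then inl q else inr (entry c2))).
  move=> /(_ _ _ _ _ _ _ _ r1) /= R1; apply: R1 => //.
  have := run_lift (nxB := @nxt (Seq c1 c2)) (j := inr) (k := omap inr).
  by move=> /(_ _ _ _ _ _ _ _ r2) /=; apply.
- have [T' r1 h1] := IH _ (rep_stay r h); exists T' => //.
  have sc : scanned (T r) = Some (inl b) by rewrite (scanned_teq (h r)) e.
  case: b e IH r1 sc => e IH r1 sc.
    apply: (run_step (q := Some (inl (entry c1)))).
      by rewrite /fire /= sc.
    have := run_lift (nxB := @nxt (If r c1 c0)) (j := fun q => Some (inl q))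
      (k := omap (fun q => Some (inl q))).
    by move=> /(_ _ _ _ _ _ _ _ r1) /=; rewrite sc; apply.
  apply: (run_step (q := Some (inr (entry c0)))).
    by rewrite /fire /= sc.
  have := run_lift (nxB := @nxt (If r c1 c0)) (j := fun q => Some (inr q))
    (k := omap (fun q => Some (inr q))).
  by move=> /(_ _ _ _ _ _ _ _ r1) /=; rewrite sc; apply.
- have sc : scanned (T r) = None by rewrite (scanned_teq (h r)) e.
  exists (upd T r (act (scanned (T r), Stay) (T r))); last exact: rep_stay.
  by apply: run_exit; rewrite /fire /= sc.
- have [T1 r1 h1] := IH1 _ (rep_stay r h); have [T2 r2 h2] := IH2 _ h1.
  exists T2 => //.
  have sc : scanned (T r) = Some (inl b) by rewrite (scanned_teq (h r)) e.
  apply: (run_step (q := Some (entry c))).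
    by rewrite /fire /= sc.
  have := run_lift (nxB := @nxt (While r c)) (j := @Some _) (k := @Some _).
  by move=> /(_ _ _ _ _ _ _ _ r1) /=; rewrite sc; apply.
- have sc : scanned (T r) = None by rewrite (scanned_teq (h r)) e.
  exists (upd T r (act (scanned (T r), Stay) (T r))); last exact: rep_stay.
  by apply: run_exit; rewrite /fire /= sc.
Qed.

Fixpoint maxreg (c : cmd) : nat :=
  match c with
  | Push r _ | Pop r => r
  | Seq a b => maxn (maxreg a) (maxreg b)
  | If r a b => maxn r (maxn (maxreg a) (maxreg b))
  | While r a => maxn r (maxreg a)
  end.

Lemma nxt_maxreg c (p : pos c) : (nxt p).1 <= maxreg c.
Proof.
elim: c p => [r b|r|a IHa b IHb|r a IHa b IHb|r a IHa] //=.
- by case=> p; rewrite /lift /= leq_max (IHa, IHb) ?orbT.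
- by case=> [[p|p]|]; rewrite /lift /= !leq_max ?leqnn ?IHa ?IHb ?orbT.
- by case=> [p|]; rewrite /lift /= !leq_max ?leqnn ?IHa ?orbT.
Qed.

(** * The machine of a program *)

Section Compile.

Variables (c : cmd) (out : nat).

Let K := (maxn (maxreg c) out).+1.

(** [inl None] marks the end of the program; one further step inspects the top of [out] and halts in
    [inr b], whence the [t.+1] steps in [compile_correct]. *)
Definition ctrl : finType := (option (pos c) + bool)%type.

Definition compiled_delta (q : ctrl) (f : {ffun 'I_K -> sym}) :
    ctrl * ('I_K -> sym * move) :=
  match q with
  | inl (Some p) =>
      let o := (nxt p).2 (f (inord (nxt p).1)) in
      (inl o.1, fun i => if i == inord (nxt p).1 then o.2 else (f i, Stay))
  | inl None => (inr (f (inord out) == Some (inl true)), fun i => (f i, Stay))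
  | inr b => (q, fun i => (f i, Stay))
  end.

Definition compile : machine :=
  @Machine K void ctrl (inl (Some (entry c)))
    (fun q => if q is inr b then Some b else None) compiled_delta.

Definition agree (C : 'I_K -> tp) (T : nat -> tp) := forall i, teq (C i) (T i).

Lemma compile_step (p : pos c) C T : agree C T ->
  let o := @fire (pos c) (nxt p) T in
  exists2 C', step (M := compile) (inl (Some p), C) = (inl o.1, C')
            & agree C' o.2.
Proof.
move=> h; have hr : (nxt p).1 < K by rewrite ltnS leq_max nxt_maxreg.
have sc : [ffun i => scanned (C i)] (inord (nxt p).1) = scanned (T (nxt p).1).
  by rewrite ffunE (scanned_teq (h _)) inordK.
eexists; first by rewrite /step /= sc; reflexivity.
move=> i /=.
have ei : (i == inord (nxt p).1) = (i == (nxt p).1 :> nat).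
  by rewrite -val_eqE /= inordK.
rewrite /upd ei; case: eqP => [e|_].
  have -> : i = inord (nxt p).1 by apply/eqP; rewrite ei e.
  by apply: act_teq; have := h (inord (nxt p).1); rewrite inordK.
by rewrite ffunE; apply: (teq_trans (act_stay _) (h i)).
Qed.

Lemma compile_run (p : pos c) T t T' : run (@nxt c) p T t T' ->
  forall C, agree C T ->
  exists2 C', iter t (@step compile) (inl (Some p), C) = (inl None, C')
            & agree C' T'.
Proof.
elim=> {p T t T'} [p T T' e|p q T T1 T' t e _ IH] C h.
  by have := compile_step p h; rewrite e /= => -[C' -> h']; exists C'.
have := compile_step p h; rewrite e /= => -[C' e' h'].
by have [C2 e2 h2] := IH _ h'; exists C2 => //; rewrite -iterS iterSr e' e2.
Qed.

Lemma compile_correct s t s' xs : exec c s t s' -> (s =1 nth [::] xs) ->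
  verdict (iter t.+1 (@step compile) (init compile xs)).1 =
    Some (ohead (s' out) == Some true).
Proof.
move=> e hs.
have [|T' r h'] := exec_run e (T := fun i => word_tape (s i)) => //.
have [|C' e' hC] := compile_run r (C := (init compile xs).2).
  by move=> i; rewrite hs.
rewrite iterS [init _ _]surjective_pairing e' /= ffunE; congr Some.
have ho : (inord out : 'I_K) = out :> nat by rewrite inordK // ltnS leq_maxr.
rewrite (scanned_teq (hC _)) ho (scanned_teq (h' out)) scanned_word.
by case: (s' out).
Qed.

End Compile.
End Tapes.

(** * Numeric functions computed in unary *)


Definition execle (c : cmd) (s : store) (t : nat) (s' : store) : Prop :=
  exists2 t', t' <= t & exec c s t' s'.

Lemma execle_le c s t t' s' : t <= t' -> execle c s t s' -> execle c s t' s'.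
Proof. by move=> le_t [u le_u e]; exists u => //; apply: leq_trans le_t. Qed.

Lemma execle_seq a b s t1 s1 t2 s2 :
  execle a s t1 s1 -> execle b s1 t2 s2 -> execle (Seq a b) s (t1 + t2) s2.
Proof.
move=> [u le_u eu] [w le_w ew]; exists (u + w); first exact: leq_add.
exact: exec_seq ew.
Qed.

Lemma execle_push s r b s' : upd s r (b :: s r) = s' -> execle (Push r b) s 2 s'.
Proof. by move=> <-; exists 2 => //; constructor. Qed.

Lemma execle_pop s r s' : upd s r (behead (s r)) = s' -> execle (Pop r) s 1 s'.
Proof. by move=> <-; exists 1 => //; constructor. Qed.

(** [S j] is the store with [j] rounds to go, so the loop descends from [S n] to [S 0]. Each round
    pays one step for its test, and the failing test one more. *)
Lemma execle_while r c (S : nat -> store) D n :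
  S 0 r = [::] -> (forall j, j < n -> S j.+1 r <> [::]) ->
  (forall j, j < n -> execle c (S j.+1) D (S j)) ->
  execle (While r c) (S n) (n * D.+1 + 1) (S 0).
Proof.
move=> S0; elim: n => [|n IH] hS hc; first by exists 1 => //; constructor.
have [j /ltnW/hS //|j /ltnW/hc //|u le_u eu] := IH.
have [w le_w ew] := hc n (leqnn _).
have := hS n (leqnn _); case Sr: (S n.+1 r) => [//|b l] _.
by exists (w + u).+1; [lia | apply: (exec_while Sr ew eu)].
Qed.

Ltac upd_cases :=
  rewrite /upd; repeat (case: eqP => ?; subst); rewrite //=; try lia.

Ltac store_eq := apply: functional_extensionality => ?; upd_cases.

(** * Moving the contents of a stack *)

Section Transfer.

Variables (j s : nat).
Hypothesis neq_js : j != s.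

Definition transfer_bit : cmd :=
  If j (Seq (Pop j) (Push s true)) (Seq (Pop j) (Push s false)).

Lemma execle_transfer_bit (S : store) :
  execle transfer_bit S 4
    (if S j is b :: w then upd (upd S j w) s (b :: S s) else S).
Proof.
case Sj: (S j) => [|b w]; first by exists 1 => //; apply: exec_if_nil.
exists 4 => //; apply: (exec_if Sj).
have -> : upd (upd S j w) s (b :: S s) =
    upd (upd S j (behead (S j))) s (b :: (upd S j (behead (S j))) s).
  by rewrite Sj /= updE eq_sym (negbTE neq_js).
by case: b Sj => _; apply: (exec_seq (t1 := 1) (t2 := 2)); constructor.
Qed.

Definition pour : cmd := While j transfer_bit.

Lemma execle_pour (S : store) :
  execle pour S (5 * size (S j) + 1)
    (upd (upd S s (catrev (S j) (S s))) j [::]).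
Proof.
have njs : (s == j) = false by rewrite eq_sym; apply/negbTE.
set w := S j; set n := size w.
(* The store with [i] letters still on [j], indexed by what remains as [execle_while] requires. *)
pose F i := upd (upd S s (catrev (take (n - i) w) (S s))) j (drop (n - i) w).
have -> : S = F n.
  by rewrite /F subnn take0 drop0; store_eq.
have -> : upd (upd (F n) s (catrev w (F n s))) j [::] = F 0.
  rewrite /F subn0 subnn take0 drop0 take_size drop_size /=.
  by apply: functional_extensionality => z; rewrite /upd njs eqxx; case: eqP => // _; case: eqP.
apply: execle_le (execle_while (D := 4) _ _ _); first by lia.
- by rewrite /F /upd eqxx subn0 drop_size.
- move=> i lt_in; rewrite /F /upd eqxx => /(congr1 size).
  by rewrite size_drop /=; lia.
move=> i lt_in; have := execle_transfer_bit (F i.+1).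
have e : drop (n - i.+1) w = nth false w (n - i.+1) :: drop (n - i) w.
  by rewrite (drop_nth false) /n; [congr (_ :: drop _ _); lia | rewrite -/n; lia].
have -> : F i.+1 j = drop (n - i.+1) w by rewrite /F /upd eqxx.
rewrite e.
suff -> : upd (upd (F i.+1) j (drop (n - i) w)) s
    (nth false w (n - i.+1) :: F i.+1 s) = F i by [].
apply: functional_extensionality => z; rewrite /F /upd njs eqxx.
have [->|_] := eqVneq z s; last by case: eqP.
rewrite njs.
have -> : n - i = (n - i.+1).+1 by lia.
by rewrite (take_nth false) -/n; [rewrite !catrevE rev_rcons | lia].
Qed.

End Transfer.

(* Contexts of numeric functions: [wds] lists the input words, [nums] the values of
   the numeric variables. *)
Structure ctx :=
  Ctx { csort :> Type; wds : csort -> seq word; nums : csort -> seq nat }.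

Definition ext (C : ctx) : ctx :=
  @Ctx (C * nat) (fun c => wds c.1) (fun c => rcons (nums c.1) c.2).

(** Numeric variables count with their value, not their logarithm, because registers are unary. *)
Definition mu (C : ctx) (c : C) : nat := sumn [seq size w | w <- wds c] + sumn (nums c).

Lemma mu_ext (C : ctx) (c : ext C) : mu c = mu c.1 + c.2.
Proof. by rewrite /mu /= sumn_rcons addnA. Qed.

(** The base is at least 2, so that constants and sums are absorbed by a larger exponent and no
    coefficients occur. *)
Definition pb (C : ctx) (f : C -> nat) : Prop :=
  exists e, forall c, f c <= (mu c).+2 ^ e.

Lemma leq_expl m n e : m <= n -> m ^ e <= n ^ e.
Proof. by case: e => // e; rewrite leq_exp2r. Qed.

Section PolyBounded.

Variable C : ctx.
Implicit Types f g : C -> nat.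

Lemma pb_le f g : (forall c, f c <= g c) -> pb g -> pb f.
Proof. by move=> h [e he]; exists e => c; apply: leq_trans (he c). Qed.

Lemma pb_mul f g : pb f -> pb g -> pb (fun c => f c * g c).
Proof.
by move=> [e he] [d hd]; exists (e + d) => c; rewrite expnD leq_mul.
Qed.

Lemma pb_const n : pb (fun _ : C => n).
Proof.
exists n => c; apply: leq_trans (ltnW (ltn_expl n (ltnSn 1))) _.
exact: leq_expl.
Qed.

Lemma pb_add f g : pb f -> pb g -> pb (fun c => f c + g c).
Proof.
move=> [e he] [d hd]; exists (maxn e d).+1 => c; rewrite expnS.
have he' : (mu c).+2 ^ e <= (mu c).+2 ^ maxn e d by rewrite leq_exp2l // leq_maxl.
have hd' : (mu c).+2 ^ d <= (mu c).+2 ^ maxn e d by rewrite leq_exp2l // leq_maxr.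
have := he c; have := hd c; nia.
Qed.

Lemma pb_mu : pb (@mu C).
Proof. by exists 1 => c; rewrite expn1; lia. Qed.

Lemma pb_exp f e : pb f -> pb (fun c => (f c).+2 ^ e).
Proof.
move=> pf; elim: e => [|e IH]; first exact: pb_const.
apply: pb_le (pb_mul (pb_add pf (pb_const 2)) IH) => c.
by rewrite expnS addn2.
Qed.

End PolyBounded.

Ltac pb_tac := repeat first
  [ eassumption | exact: pb_mu | exact: pb_const
  | match goal with
    | |- pb (fun c => @?f c + @?g c) => apply: (@pb_add _ f g)
    | |- pb (fun c => @?f c * @?g c) => apply: (@pb_mul _ f g)
    | |- pb (fun c => (@?f c).+2 ^ ?e) => apply: (@pb_exp _ f e)
    end ].

(** * Functions realised by programs on unary registers *)

Section Realizable.

Variable k : nat.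

(* The tapes below [k] hold the input words, the tape [k + i] holds the
   numeric register [i] in unary. *)
Definition st (ws : seq word) (v : nat -> nat) : store :=
  fun r => if r < k then nth [::] ws r else nseq (v (r - k)) true.

Lemma st_word ws v j : j < k -> st ws v j = nth [::] ws j.
Proof. by rewrite /st => ->. Qed.

Lemma st_num ws v i : st ws v (k + i) = nseq (v i) true.
Proof. by rewrite /st ltnNge leq_addr addKn. Qed.

Lemma upd_st ws v i n : upd (st ws v) (k + i) (nseq n true) = st ws (upd v i n).
Proof.
apply: functional_extensionality => z; rewrite /upd /st.
have [->|ne] := eqVneq z (k + i); first by rewrite ltnNge leq_addr addKn eqxx.
by case: ltnP => // le_kz; case: eqP => // e; case/eqP: ne; lia.
Qed.

Lemma execle_inc ws v i : execle (Push (k + i) true) (st ws v) 2 (st ws (upd v i (v i).+1)).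
Proof. by apply: execle_push; rewrite st_num -upd_st. Qed.

Lemma execle_dec ws v i : execle (Pop (k + i)) (st ws v) 1 (st ws (upd v i (v i).-1)).
Proof. by apply: execle_pop; rewrite st_num -upd_st; case: (v i). Qed.

Lemma execle_while_st i c ws (V : nat -> nat -> nat) D n :
  (forall j, j <= n -> V j i = j) ->
  (forall j, j < n -> execle c (st ws (V j.+1)) D (st ws (V j))) ->
  execle (While (k + i) c) (st ws (V n)) (n * D.+1 + 1) (st ws (V 0)).
Proof.
move=> hV; apply: (execle_while (S := fun j => st ws (V j))).
  by rewrite st_num hV.
by move=> j lt_jn; rewrite st_num hV.
Qed.

Definition clear (i : nat) : cmd := While (k + i) (Pop (k + i)).

Lemma execle_clear ws v i :
  execle (clear i) (st ws v) (2 * v i + 1) (st ws (upd v i 0)).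
Proof.
have := @execle_while_st i (Pop (k + i)) ws (fun j => upd v i j) 1 (v i).
have -> : upd v i (v i) = v by store_eq.
rewrite mulnC; apply=> j lt_j; first by rewrite /upd eqxx.
have -> : upd v i j = upd (upd v i j.+1) i (upd v i j.+1 i).-1.
  by rewrite updE eqxx; store_eq.
exact: execle_dec.
Qed.

Definition shift (a o : nat) : cmd :=
  While (k + a) (Seq (Pop (k + a)) (Push (k + o) true)).

Lemma execle_shift ws v a o : a != o ->
  execle (shift a o) (st ws v) (4 * v a + 1)
    (st ws (upd (upd v o (v o + v a)) a 0)).
Proof.
move=> /eqP ne.
have := @execle_while_st a (Seq (Pop (k + a)) (Push (k + o) true)) ws
  (fun j => upd (upd v o (v o + (v a - j))) a j) 3 (v a).
rewrite subnn addn0 subn0 mulnC.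
have -> : upd (upd v o (v o)) a (v a) = v by store_eq.
apply=> j lt_j; first by rewrite /upd eqxx.
apply: (execle_seq (t1 := 1) (t2 := 2)); first exact: execle_dec.
set w := upd _ _ _; have -> : upd (upd v o (v o + (v a - j))) a j = upd w o (w o).+1.
  by rewrite /w; store_eq.
exact: execle_inc.
Qed.

(** A loop consumes its counter, so the value is written twice and the second copy is moved back to
    [a]. *)
Definition copy (a o q : nat) : cmd :=
  Seq (While (k + a) (Seq (Pop (k + a)) (Seq (Push (k + o) true) (Push (k + q) true))))
      (shift q a).

Lemma execle_copy ws v a o q : a != o -> a != q -> o != q -> v q = 0 ->
  execle (copy a o q) (st ws v) (10 * v a + 2) (st ws (upd v o (v o + v a))).
Proof.
move=> /eqP ne1 /eqP ne2 /eqP ne3 vq.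
have -> : 10 * v a + 2 = v a * 6 + 1 + (4 * v a + 1) by lia.
pose V j := upd (upd (upd v o (v o + (v a - j))) a j) q (v a - j).
apply: (execle_seq (s1 := st ws (V 0))).
  have {1}-> : v = V (v a) by rewrite /V subnn; store_eq.
  apply: execle_while_st => j lt_j; first by rewrite /V; upd_cases.
  apply: (execle_seq (t1 := 1) (t2 := 4)); first exact: execle_dec.
  apply: (execle_seq (t1 := 2) (t2 := 2)); first exact: execle_inc.
  set w := upd _ _ _; have -> : V j = upd w q (w q).+1.
    by rewrite /w /V; store_eq.
  exact: execle_inc.
have -> : 4 * v a = 4 * V 0 q by rewrite /V /upd eqxx subn0.
have -> : upd v o (v o + v a) = upd (upd (V 0) a (V 0 a + V 0 q)) q 0.
  by rewrite /V; store_eq.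
by apply: execle_shift; apply/eqP/nesym.
Qed.

(* [f] is computed in polynomial time from numeric arguments in arbitrary
   registers [rs], with the result and the work space beyond them. *)
Definition rn (C : ctx) (f : C -> nat) : Prop :=
  pb f /\ forall rs o, all (fun r => r < o) rs ->
    exists cm tm, pb tm /\ forall (c : C) v,
      [seq v r | r <- rs] = nums c -> (forall i, o <= i -> v i = 0) ->
      execle cm (st (wds c) v) (tm c) (st (wds c) (upd v o (f c))).

Lemma rn_eq (C : ctx) (f g : C -> nat) : f =1 g -> rn f -> rn g.
Proof.
move=> fg [[e he] h]; split; first by exists e => c; rewrite -fg.
move=> rs o /h[cm [tm [ptm hc]]]; exists cm, tm; split=> // c v hv h0.
by rewrite -fg; apply: hc.
Qed.

Lemma rn_zero (C : ctx) : rn (fun _ : C => 0).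
Proof.
split; first exact: pb_const.
(* Register [o] is already 0, so clearing it is a command that changes nothing. *)
move=> rs o _; exists (clear o), (fun=> 1); split; first exact: pb_const.
by move=> c v _ h0; apply: execle_le (execle_clear _ _ _); rewrite h0.
Qed.

Lemma rn_succ (C : ctx) (f : C -> nat) : rn f -> rn (fun c => (f c).+1).
Proof.
move=> [pf hf]; split.
  by apply: pb_le (pb_add pf (pb_const _ 1)) => c; rewrite addn1.
move=> rs o /hf[cm [tm [ptm hc]]].
exists (Seq cm (Push (k + o) true)), (fun c => tm c + 2).
split; first exact: pb_add ptm (pb_const _ 2).
move=> c v hv h0; apply: execle_seq (hc c v hv h0) _.
have -> : upd v o (f c).+1 = upd (upd v o (f c)) o (upd v o (f c) o).+1 by store_eq.
exact: execle_inc.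
Qed.

Lemma rn_last (C : ctx) : rn (fun c : ext C => c.2).
Proof.
split; first by apply: pb_le (pb_mu _) => c; rewrite mu_ext leq_addl.
case/lastP=> [|rs a] o.
  (* An extended context has at least one numeric value, so an empty list of registers is
     contradictory and any command will do. *)
  move=> _; exists (Pop 0), (fun=> 0); split; first exact: pb_const.
  by move=> c v /=; case: (nums c.1).
rewrite all_rcons => /andP[lt_ao _].
exists (copy a o o.+1), (fun c => 10 * c.2 + 2); split.
  apply: pb_add (pb_mul _ _) (pb_const _ _); first exact: pb_const.
  by apply: pb_le (pb_mu _) => c; rewrite mu_ext leq_addl.
move=> c v; rewrite map_rcons => /rcons_inj[_ <-] h0.
have -> : upd v o (v a) = upd v o (v o + v a) by rewrite (h0 o).
by apply: execle_copy; rewrite ?h0 //; lia.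
Qed.

(** Arguments may sit in arbitrary registers, so the program of [f] is reused as it is, with the
    last register dropped from its argument list. *)
Lemma rn_wk (C : ctx) (f : C -> nat) : rn f -> rn (C := ext C) (fun c => f c.1).
Proof.
have pw (g : C -> nat) : pb g -> pb (C := ext C) (fun c => g c.1).
  case=> e he; exists e => c; apply: leq_trans (he _) _.
  by apply: leq_expl; rewrite mu_ext !ltnS leq_addr.
move=> [pf hf]; split; first exact: pw.
case/lastP=> [|rs a] o.
  move=> _; exists (Pop 0), (fun=> 0); split; first exact: pb_const.
  by move=> c v /=; case: (nums c.1).
rewrite all_rcons => /andP[_ /hf[cm [tm [ptm hc]]]].
exists cm, (fun c => tm c.1); split; first exact: pw.
by move=> c v; rewrite map_rcons => /rcons_inj[/hc h _]; apply: h.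
Qed.

End Realizable.


(** * Access to the input words, and bounded recursion *)

Section Primitives.
Variable k : nat.
Notation st := (st k).

Lemma size_mu (C : ctx) (c : C) j : size (nth [::] (wds c) j) <= mu c.
Proof.
apply: leq_trans (leq_addr _ _); elim: (wds c) j => [|w ws IH] [|j] //=.
  exact: leq_addr.
exact: leq_trans (IH j) (leq_addl _ _).
Qed.

(** Counting the letters removes them from tape [j]; they are stacked on a scratch tape and poured
    back, which restores their order. *)
Lemma rn_size (C : ctx) j : j < k -> rn k (fun c : C => size (nth [::] (wds c) j)).
Proof.
move=> lt_jk; split; first by apply: pb_le (pb_mu _) => c; apply: size_mu.
move=> rs o _; set s := k + o.+1; set r := k + o.
have njs : j != s by lia.
have nrs : r != s by lia.
have nrj : r != j by lia.
exists (Seq (While j (Seq (transfer_bit j s) (Push r true))) (pour s j)).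
exists (fun c => mu c * 7 + 1 + (5 * mu c + 1)); split.
  by pb_tac.
move=> c v _ h0; set w := nth _ _ _; set n := size w.
have le_n : n <= mu c by apply: size_mu.
have njs' : (s == j) = false by rewrite eq_sym; apply/negbTE.
have nrj' : (j == r) = false by rewrite eq_sym; apply/negbTE.
have nrs' : (s == r) = false by rewrite eq_sym; apply/negbTE.
pose S := st (wds c) v.
pose F i := upd (upd (upd S s (rev (take (n - i) w))) j (drop (n - i) w))
  r (nseq (n - i) true).
have Sr : S r = [::] by rewrite /S st_num h0.
have Ss : S s = [::] by rewrite /S st_num h0.
have Sj : S j = w by rewrite /S st_word.
have FE : F n = S.
  rewrite /F subnn take0 drop0; apply: functional_extensionality => z.
  rewrite /upd; case: eqP => [->|_] //; case: eqP => [->|_] //.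
  by case: eqP => [->|_].
have F0s : F 0 s = rev w by rewrite /F /upd nrs' njs' eqxx subn0 take_size.
have F0j : F 0 j = [::] by rewrite /F /upd nrj' eqxx subn0 drop_size.
have FS : upd (upd (F 0) j (catrev (F 0 s) (F 0 j))) s [::] =
    st (wds c) (upd v o n).
  rewrite F0s F0j catrevE revK cats0 -upd_st -/S -/r /F subn0 take_size drop_size.
  apply: functional_extensionality => z; rewrite /upd.
  have [->|_] := eqVneq z s; first by rewrite nrs'.
  by have [->|_] := eqVneq z j; first by rewrite nrj'.
rewrite -FS -[st _ v]FE; apply: (execle_seq (s1 := F 0)); last first.
  apply: execle_le (execle_pour _ _); last by rewrite eq_sym.
  by rewrite F0s size_rev -/n; lia.
apply: execle_le (execle_while (D := 6) _ _ _); first by lia.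
- exact: F0j.
- move=> i lt_in; rewrite /F /upd nrj' eqxx => /(congr1 size).
  by rewrite size_drop /=; lia.
move=> i lt_in; apply: (execle_seq (t1 := 4) (t2 := 2)).
  exact: execle_transfer_bit.
have e : drop (n - i.+1) w = nth false w (n - i.+1) :: drop (n - i) w.
  by rewrite (drop_nth false) /n; [congr (_ :: drop _ _); lia | rewrite -/n; lia].
have -> : F i.+1 j = drop (n - i.+1) w by rewrite /F /upd nrj' eqxx.
rewrite e; apply: execle_push.
have e2 : n - i = (n - i.+1).+1 by lia.
apply: functional_extensionality => z; rewrite /F e2 /upd nrs' njs' eqxx.
rewrite (negbTE nrs) (negbTE nrj) eqxx (take_nth false) -/n; last by lia.
have [_|_] := eqVneq z r; first by [].
have [->|_] := eqVneq z s; first by rewrite njs' rev_rcons.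
by case: eqP.
Qed.

(** The letters in front of the wanted one are moved to a scratch tape, the top of tape [j] is
    inspected, and the letters are poured back. Beyond the end of the word [transfer_bit] and [If]
    do nothing, which leaves 0, the default [false] of [nth]. *)
Lemma rn_bit (C : ctx) j (f : C -> nat) : j < k -> rn k f ->
  rn k (fun c => nth false (nth [::] (wds c) j) (f c) : nat).
Proof.
move=> lt_jk [pf hf]; split.
  by apply: pb_le (pb_const _ 1) => c; case: nth.
move=> rs o /hf[cm [tm [ptm hc]]]; set s := k + o.+1; set r := k + o.
have njs : j != s by lia.
have nrs : r != s by lia.
have nrj : r != j by lia.
exists (Seq cm (Seq (While r (Seq (Pop r) (transfer_bit j s)))
  (Seq (If j (Push r true) (Pop r)) (pour s j)))).
exists (fun c => tm c + (f c * 6 + 1 + (3 + (5 * f c + 1)))); split.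
  by pb_tac.
move=> c v hv h0; apply: (execle_seq (hc c v hv h0)).
set w := nth [::] _ _; set n := f c.
have njs' : (s == j) = false by rewrite eq_sym; apply/negbTE.
have nrj' : (j == r) = false by rewrite eq_sym; apply/negbTE.
have nrs' : (s == r) = false by rewrite eq_sym; apply/negbTE.
pose S := st (wds c) v.
pose F i := upd (upd (upd S s (rev (take (n - i) w))) j (drop (n - i) w))
  r (nseq i true).
have Ss : S s = [::] by rewrite /S st_num h0.
have Sr : S r = [::] by rewrite /S st_num h0.
have Sj : S j = w by rewrite /S st_word.
have FE : F n = st (wds c) (upd v o n).
  rewrite /F subnn take0 drop0 -upd_st; apply: functional_extensionality => z.
  rewrite /upd; case: eqP => // _; case: eqP => [->|_] //.
  by case: eqP => [->|_].
rewrite -FE; apply: (execle_seq (s1 := F 0)).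
  apply: execle_while => [|i lt_in|i lt_in].
  - by rewrite /F /upd eqxx.
  - by rewrite /F /upd eqxx.
  apply: (execle_seq (t1 := 1) (t2 := 4)); first exact: execle_pop.
  set G := upd _ _ _; have := execle_transfer_bit njs G.
  have -> : G j = drop (n - i.+1) w by rewrite /G /F /upd nrj' eqxx.
  suff -> : F i = (if drop (n - i.+1) w is b :: w0
                   then upd (upd G j w0) s (b :: G s) else G) by [].
  have -> : G s = rev (take (n - i.+1) w).
    by rewrite /G /F /upd nrs' njs' eqxx.
  have -> : G = upd (upd (upd S s (rev (take (n - i.+1) w))) j
      (drop (n - i.+1) w)) r (nseq i true).
    rewrite /G /F /=; apply: functional_extensionality => z.
    by rewrite /upd eqxx /=; case: eqP.
  rewrite /F; have -> : n - i = (n - i.+1).+1 by lia.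
  have [lt_w|le_w] := ltnP (n - i.+1) (size w); last first.
    rewrite (drop_oversize le_w) (take_oversize le_w) (drop_oversize (leqW le_w)).
    by rewrite (take_oversize (leqW le_w)).
  rewrite [drop (n - i.+1) w](drop_nth false lt_w) (take_nth false lt_w).
  apply: functional_extensionality => z; rewrite /upd.
  have [->|_] := eqVneq z r; first by rewrite (negbTE nrs) (negbTE nrj).
  have [->|_] := eqVneq z s; first by rewrite njs' rev_rcons.
  by case: eqP.
set b := nth false w n.
have F0j : F 0 j = drop n w by rewrite /F /upd nrj' eqxx subn0.
apply: (execle_seq (t1 := 3) (s1 := upd (F 0) r (nseq b true))).
  have [le_w|lt_w] := leqP (size w) n.
    exists 1 => //; have -> : upd (F 0) r (nseq b true) = F 0.
      rewrite /b nth_default // /F; apply: functional_extensionality => z.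
      by rewrite /upd; case: eqP.
    by apply: exec_if_nil; rewrite F0j drop_oversize.
  have := F0j; rewrite (drop_nth false lt_w) -/b => e.
  have F0r : F 0 r = [::] by rewrite /F /upd eqxx.
  case: b e => e; [exists 3 | exists 2] => //; apply: (exec_if e).
    have -> : nseq true true = true :: F 0 r by rewrite F0r.
    by constructor.
  have -> : nseq false true = behead (F 0 r) by rewrite F0r.
  by constructor.
set G := upd _ _ _.
have Gs : G s = rev (take n w) by rewrite /G /F /upd nrs' njs' eqxx subn0.
have Gj : G j = drop n w by rewrite /G /F /upd nrj' eqxx subn0.
have -> : st (wds c) (upd v o b) = upd (upd G j (catrev (G s) (G j))) s [::].
  rewrite Gs Gj catrevE revK cat_take_drop -upd_st -/S -/r /G /F.
  apply: functional_extensionality => z; rewrite /upd.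
  have [->|_] := eqVneq z s; first by rewrite nrs'.
  have [->|_] := eqVneq z j; first by rewrite nrj'.
  by case: eqP.
apply: execle_le (execle_pour _ _); last by rewrite eq_sym.
by rewrite Gs size_rev size_take; case: ltnP; lia.
Qed.

(** Limited recursion: a polynomial number of rounds alone may yield exponential values, and [g],
    which bounds the accumulator after every round, excludes this. It also bounds the measure of the
    context in which [h] is run, hence the cost of a round. *)
Lemma rn_iteri (C : ctx) (t a g : C -> nat) (h : C -> nat -> nat -> nat) :
  rn k t -> rn k a -> rn k (C := ext (ext C)) (fun c => h c.1.1 c.1.2 c.2) ->
  pb g -> (forall c i, i <= t c -> iteri i (h c) (a c) <= g c) ->
  rn k (fun c => iteri (t c) (h c) (a c)).
Proof.
move=> [pt ht] [pa ha] [_ hh] pg hg; split.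
  by apply: pb_le pg => c; apply: hg.
move=> rs o hrs.
have [Ct [tt [ptt hCt]]] := ht _ _ hrs.
have [|Ca [ta [pta hCa]]] := ha rs (o + 2).
  by apply: sub_all hrs => r; lia.
have [|Ch [th [[e he] hCh]]] := hh (rcons (rcons rs (o + 1)) (o + 2)) (o + 3).
  rewrite !all_rcons; apply/and3P; split; try lia.
  by apply: sub_all hrs => r; lia.
(* Register [o] counts the rounds to come, [o + 1] those done, and [o + 2] is the accumulator. [Ch]
   reads the latter two and writes to [o + 3], from where the result is shifted to the cleared
   [o + 2]. *)
pose body := Seq (Pop (k + o)) (Seq Ch (Seq (clear k (o + 2))
  (Seq (shift k (o + 3) (o + 2)) (Push (k + (o + 1)) true)))).
exists (Seq Ct (Seq Ca (Seq (While (k + o) body)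
  (Seq (clear k (o + 1)) (shift k (o + 2) o))))).
(* The power bounds the time of [Ch]: the context extended by the index and the accumulator has
   measure at most [mu c + t c + g c]. *)
pose D c := 1 + ((mu c + t c + g c).+2 ^ e + ((2 * g c + 1) + ((4 * g c + 1) + 2))).
exists (fun c => tt c + (ta c + (t c * (D c + 1) + 1 + ((2 * t c + 1) + (4 * g c + 1))))).
split; first by rewrite /D; pb_tac.
move=> c v hv h0; set n := t c; set A := fun i => iteri i (h c) (a c).
have h1 := h0 (o + 1) (leq_addr _ _).
have h2 := h0 (o + 2) (leq_addr _ _).
have h3 := h0 (o + 3) (leq_addr _ _).
pose V j := upd (upd (upd v o j) (o + 1) (n - j)) (o + 2) (A (n - j)).
apply: (execle_seq (hCt c v hv h0)).
apply: (execle_seq (s1 := st (wds c) (V n))).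
  have := hCa c (upd v o n).
  have -> : upd (upd v o n) (o + 2) (a c) = V n.
    by rewrite /V /A subnn /=; store_eq.
  apply.
    rewrite -hv; apply/eq_in_map => r /(allP hrs) lt_r.
    by rewrite /upd; case: eqP => //; lia.
  by move=> i le_i; rewrite /upd; case: eqP => [|_]; [lia | apply: h0; lia].
have Ag i : i <= n -> A i <= g c by apply: hg.
have Vo j : V j o = j by rewrite /V; upd_cases.
have Vo1 j : V j (o + 1) = n - j by rewrite /V; upd_cases.
have Vo2 j : V j (o + 2) = A (n - j) by rewrite /V; upd_cases.
apply: (execle_seq (s1 := st (wds c) (V 0))); last first.
  apply: (execle_seq (s1 := st (wds c) (upd (V 0) (o + 1) 0))).
    by apply: execle_le (execle_clear _ _ _ _); rewrite Vo1 subn0.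
  have := @execle_shift k (wds c) (upd (V 0) (o + 1) 0) (o + 2) o.
  set w := upd (upd _ _ _) _ _.
  have -> : w = upd v o (A n).
    by rewrite /w /V subn0; store_eq.
  have -> : upd (V 0) (o + 1) 0 (o + 2) = A n.
    by rewrite -[n]subn0 -Vo2; upd_cases.
  by move=> H; apply: execle_le (H _); [have := Ag n (leqnn _); lia | lia].
rewrite [D c + 1]addn1; apply: execle_while_st => // j lt_j.
have Aj : A (n - j) = h c (n - j.+1) (A (n - j.+1)).
  by rewrite /A; have -> : n - j = (n - j.+1).+1 by lia.
set i := n - j.+1 in Aj.
have le_Ai : A i <= g c by apply: Ag; rewrite /i; lia.
have le_Aj : A (n - j) <= g c by apply: Ag; lia.
pose v1 := upd (V j.+1) o j.
apply: (execle_seq (s1 := st (wds c) v1)).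
  have -> : v1 = upd (V j.+1) o (V j.+1 o).-1 by rewrite Vo.
  exact: execle_dec.
pose v2 := upd v1 (o + 3) (A (n - j)).
apply: (execle_seq (s1 := st (wds c) v2)).
  have := hCh (c, i, A i) v1; rewrite /v2 Aj => H; apply: execle_le (H _ _) => //.
  - apply: leq_trans (he _) _; apply: leq_expl; rewrite !mu_ext /=.
    have : i <= n by rewrite /i; lia.
    by rewrite /n; lia.
  - rewrite !map_rcons /=; congr (rcons (rcons _ _) _).
    + rewrite -hv; apply/eq_in_map => r /(allP hrs) lt_r.
      by rewrite /v1 /V; upd_cases.
    + by rewrite /v1 /i -(Vo1 j.+1); upd_cases.
    by rewrite /v1 /i -(Vo2 j.+1); upd_cases.
  by move=> z le_z; rewrite /v1 /V; upd_cases; apply: h0; lia.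
pose v3 := upd v2 (o + 2) 0.
apply: (execle_seq (s1 := st (wds c) v3)).
  apply: execle_le (execle_clear _ _ _ _).
  have -> : v2 (o + 2) = A i by rewrite /v2 /v1 /i -(Vo2 j.+1); upd_cases.
  by lia.
pose v4 := upd (upd v3 (o + 2) (v3 (o + 2) + v3 (o + 3))) (o + 3) 0.
apply: (execle_seq (s1 := st (wds c) v4)).
  apply: execle_le (execle_shift _ _ _ _); last by lia.
  have -> : v3 (o + 3) = A (n - j) by rewrite /v3 /v2; upd_cases.
  by lia.
have -> : V j = upd v4 (o + 1) (v4 (o + 1)).+1.
  have e4 : v4 (o + 1) = i by rewrite /v4 /v3 /v2 /v1 /i -(Vo1 j.+1); upd_cases.
  have e5 : v4 (o + 2) = A (n - j) by rewrite /v4 /v3 /v2; upd_cases.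
  apply: functional_extensionality => z.
  rewrite updE; have [->|n1] := eqVneq z (o + 1).
    by rewrite e4 Vo1 /i; lia.
  have [->|n2] := eqVneq z (o + 2); first by rewrite e5 Vo2.
  by rewrite /v4 /v3 /v2 /v1 /V; upd_cases.
exact: execle_inc.
Qed.

End Primitives.

(** * Closure properties *)


Definition inputs : ctx := @Ctx (seq word) id (fun _ => [::]).

Lemma ptime_rn k (R : seq word -> bool) :
  rn k (C := inputs) (fun ws => R ws) -> ptime_relation k R.
Proof.
move=> [_ /(_ [::] 0 isT)[cm [tm [[e he] hcm]]]].
(* For inputs of total length [n > 0] one has [n + 2 <= 3 * n], which gives the factor [3 ^ e]; for
   [n = 0] the additive constant covers [2 ^ e]. The successor pays for the final step that reads
   the verdict. *)
exists (compile cm (k + 0)), (3 ^ e).+1, e => xs sz.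
have [//|//|t le_t ex] := hcm xs (fun=> 0).
exists t.+1, (R xs); split=> //; last first.
  rewrite (compile_correct (k + 0) (xs := xs) ex) => [|i].
    by rewrite st_num /upd eqxx; case: (R xs).
  by rewrite /st; case: ltnP => // le_i; rewrite nth_default ?sz.
have := he xs; rewrite /mu /= addn0; set n := sumn _ => le_tm.
rewrite /poly_bound; case: n le_tm => [|n] le_tm.
  have : 2 ^ e <= 3 ^ e by apply: leq_expl.
  by lia.
have : n.+3 ^ e <= 3 ^ e * n.+1 ^ e by rewrite -expnMn leq_expl //; lia.
by nia.
Qed.

Section Closure.

Variable k : nat.

Definition rb (C : ctx) (p : C -> bool) : Prop := rn k (fun c => p c : nat).

Lemma rb_wk (C : ctx) (p : C -> bool) : rb p -> rb (C := ext C) (fun c => p c.1).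
Proof. exact: rn_wk. Qed.

Lemma rb_eq (C : ctx) (p q : C -> bool) : p =1 q -> rb p -> rb q.
Proof. by move=> e; apply: rn_eq => c; rewrite e. Qed.

Lemma rn_const (C : ctx) n : rn k (fun _ : C => n).
Proof. by elim: n => [|n IH]; [apply: rn_zero | apply: rn_succ IH]. Qed.

(** The last index seen by a loop of [n.+1] rounds is [n], and a loop of no rounds returns the
    initial 0. *)
Lemma rn_pred (C : ctx) (f : C -> nat) : rn k f -> rn k (fun c => (f c).-1).
Proof.
move=> rf; apply: (@rn_eq _ _ (fun c => iteri (f c) (fun i _ => i) 0)).
  by move=> c; case: (f c).
apply: rn_iteri rf (rn_zero _ _) _ rf.1 _ => [|c [|i] //=]; last exact: ltnW.
exact: rn_wk (rn_last _ _).
Qed.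

Lemma rn_add (C : ctx) (f g : C -> nat) : rn k f -> rn k g -> rn k (fun c => f c + g c).
Proof.
move=> rf rg.
have E n m : iteri n (fun _ => S) m = m + n.
  by elim: n => [|n IH] /=; rewrite ?addn0 // IH addnS.
apply: (@rn_eq _ _ (fun c => iteri (g c) (fun _ => S) (f c))) => [c|].
  by rewrite E.
apply: rn_iteri rg rf _ (pb_add rf.1 rg.1) _ => [|c i le_i].
  exact/rn_succ/rn_last.
by rewrite E leq_add2l.
Qed.

Lemma rn_mul (C : ctx) (f g : C -> nat) : rn k f -> rn k g -> rn k (fun c => f c * g c).
Proof.
move=> rf rg.
have E n m : iteri n (fun _ => addn^~ m) 0 = m * n.
  by elim: n => [|n IH] /=; rewrite ?muln0 // IH mulnS addnC.
apply: (@rn_eq _ _ (fun c => iteri (g c) (fun _ => addn^~ (f c)) 0)) => [c|].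
  by rewrite E.
apply: rn_iteri rg (rn_zero _ _) _ (pb_mul rf.1 rg.1) _ => [|c i le_i].
  by apply: rn_add; [apply: rn_last | apply: rn_wk (rn_wk rf)].
by rewrite E leq_mul2l le_i orbT.
Qed.

Lemma rn_sub (C : ctx) (f g : C -> nat) : rn k f -> rn k g -> rn k (fun c => f c - g c).
Proof.
move=> rf rg.
have E n m : iteri n (fun _ => predn) m = m - n.
  by elim: n => [|n IH] /=; rewrite ?subn0 // IH subnS.
apply: (@rn_eq _ _ (fun c => iteri (g c) (fun _ => predn) (f c))) => [c|].
  by rewrite E.
apply: rn_iteri rg rf _ rf.1 _ => [|c i le_i].
  exact/rn_pred/rn_last.
by rewrite E leq_subr.
Qed.

Lemma rb_neg (C : ctx) (p : C -> bool) : rb p -> rb (fun c => ~~ p c).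
Proof.
move=> rp; apply: (@rn_eq _ _ (fun c => 1 - p c)) => [c|]; first by case: (p c).
exact: rn_sub (rn_const C 1) rp.
Qed.

Lemma rb_and (C : ctx) (p q : C -> bool) : rb p -> rb q -> rb (fun c => p c && q c).
Proof.
move=> rp rq; apply: (@rn_eq _ _ (fun c => p c * q c)) => [c|].
  by rewrite mulnb.
exact: rn_mul.
Qed.

Lemma rb_or (C : ctx) (p q : C -> bool) : rb p -> rb q -> rb (fun c => p c || q c).
Proof.
move=> rp rq; apply: (@rb_eq _ (fun c => ~~ (~~ p c && ~~ q c))) => [c|].
  by rewrite -negb_or negbK.
by apply/rb_neg/rb_and; apply: rb_neg.
Qed.

Lemma rb_leq (C : ctx) (f g : C -> nat) : rn k f -> rn k g -> rb (fun c => f c <= g c).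
Proof.
move=> rf rg; apply: (@rn_eq _ _ (fun c => 1 - (f c - g c))) => [c|].
  by rewrite /leq; case: (f c - g c).
exact: rn_sub (rn_const C 1) (rn_sub rf rg).
Qed.

Lemma rb_eqn (C : ctx) (f g : C -> nat) : rn k f -> rn k g -> rb (fun c => f c == g c).
Proof.
move=> rf rg; apply: (@rb_eq _ (fun c => (f c <= g c) && (g c <= f c))) => [c|].
  by rewrite eqn_leq.
by apply: rb_and; apply: rb_leq.
Qed.

Lemma rb_eqb (C : ctx) (p q : C -> bool) : rb p -> rb q -> rb (fun c => p c == q c).
Proof.
move=> rp rq; apply: (@rb_eq _ (fun c => p c == q c :> nat)) => [c|].
  by case: (p c); case: (q c).
exact: rb_eqn.
Qed.

Lemma rn_if (C : ctx) (p : C -> bool) (f g : C -> nat) : rb p -> rn k f -> rn k g ->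
  rn k (fun c => if p c then f c else g c).
Proof.
move=> rp rf rg.
apply: (@rn_eq _ _ (fun c => p c * f c + ~~ p c * g c)) => [c|].
  by case: (p c); rewrite ?mul1n ?addn0.
by apply: rn_add; apply: rn_mul => //; apply: rb_neg.
Qed.

Lemma rn_min (C : ctx) (f g : C -> nat) : rn k f -> rn k g -> rn k (fun c => minn (f c) (g c)).
Proof. by move=> rf rg; apply: rn_if => //; apply/rb_leq => //; apply: rn_succ. Qed.

Lemma rb_all (C : ctx) (f : C -> nat) (P : C -> nat -> bool) :
  rn k f -> rb (C := ext C) (fun c => P c.1 c.2) ->
  rb (fun c => all (P c) (iota 0 (f c))).
Proof.
move=> rf rP.
have E n c : iteri n (fun i acc => acc * P c i) 1 = all (P c) (iota 0 n).
  elim: n => // n IH; rewrite -[in RHS]addn1 iotaD all_cat /= andbT add0n IH.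
  by rewrite mulnb.
apply: (@rn_eq _ _ (fun c => iteri (f c) (fun i acc => acc * P c i) 1)) => [c|].
  exact: E.
apply: rn_iteri rf (rn_const C 1) _ (pb_const _ 1) _ => [|c i _].
  by apply: rn_mul; [apply: rn_last | apply: rn_wk rP].
by rewrite E; case: all.
Qed.

Lemma rb_has (C : ctx) (f : C -> nat) (P : C -> nat -> bool) :
  rn k f -> rb (C := ext C) (fun c => P c.1 c.2) ->
  rb (fun c => has (P c) (iota 0 (f c))).
Proof.
move=> rf rP.
apply: (@rb_eq _ (fun c => ~~ all (predC (P c)) (iota 0 (f c)))) => [c|].
  by rewrite -has_predC; apply: eq_has => i /=; rewrite negbK.
by apply: rb_neg; apply: (rb_all (P := fun c => predC (P c))) => //; apply: rb_neg.
Qed.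

Lemma rn_count (C : ctx) (f : C -> nat) (P : C -> nat -> bool) :
  rn k f -> rb (C := ext C) (fun c => P c.1 c.2) ->
  rn k (fun c => count (P c) (iota 0 (f c))).
Proof.
move=> rf rP.
have E n c : iteri n (fun i acc => acc + P c i) 0 = count (P c) (iota 0 n).
  elim: n => // n IH; rewrite -[in RHS]addn1 iotaD count_cat /= addn0 add0n.
  by rewrite IH.
apply: (@rn_eq _ _ (fun c => iteri (f c) (fun i acc => acc + P c i) 0)) => [c|].
  exact: E.
apply: rn_iteri rf (rn_zero _ _) _ rf.1 _ => [|c i le_i].
  by apply: rn_add; [apply: rn_last | apply: rn_wk rP].
by rewrite E; apply: leq_trans (count_size _ _) _; rewrite size_iota.
Qed.

Lemma rb_odd (C : ctx) (f : C -> nat) : rn k f -> rb (fun c => odd (f c)).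
Proof.
move=> rf.
have E n : iteri n (fun _ acc => 1 - acc) 0 = odd n.
  by elim: n => //= n ->; case: odd.
apply: (@rn_eq _ _ (fun c => iteri (f c) (fun _ acc => 1 - acc) 0)) => [c|].
  exact: E.
apply: rn_iteri rf (rn_zero _ _) _ (pb_const _ 1) _ => [|c i _].
  exact: rn_sub (rn_const _ 1) (rn_last _ _).
by rewrite E; case: odd.
Qed.

(** There are exactly [n./2] odd numbers below [n]. *)
Lemma rn_half (C : ctx) (f : C -> nat) : rn k f -> rn k (fun c => (f c)./2).
Proof.
move=> rf; apply: (@rn_eq _ _ (fun c => count odd (iota 0 (f c)))) => [c|].
  elim: (f c) => // n IH; rewrite -addn1 iotaD count_cat IH /= add0n addn0.
  by rewrite addn1 [RHS]uphalf_half addnC.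
by apply: (rn_count (P := fun _ => odd)) => //; apply/rb_odd/rn_last.
Qed.

Lemma rb_bit (C : ctx) j (f : C -> nat) : j < k -> rn k f ->
  rb (fun c => nth false (nth [::] (wds c) j) (f c)).
Proof. exact: rn_bit. Qed.

(** The list [s] is fixed in advance and the conjunction is unrolled in the program. Its index may
    therefore select a tape, which a numeric variable cannot do. *)
Lemma rb_allm (C : ctx) (P : nat -> C -> bool) (s : seq nat) :
  (forall t, t \in s -> rb (P t)) -> rb (fun c => all (P^~ c) s).
Proof.
elim: s => [|t s IH] h; first exact: rn_const.
apply: rb_and (h _ (mem_head _ _)) (IH _) => u us.
by apply: h; rewrite inE us orbT.
Qed.

End Closure.

Ltac rn_leaf := first
  [ eassumption | exact: rn_last | exact: rn_const
  | exact: (rn_wk (rn_last _ _)) | exact: (rn_wk (rn_wk (rn_last _ _)))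
  | exact: (rn_wk (rn_wk (rn_wk (rn_last _ _))))
  | match goal with
    | H : rn _ _ |- _ => first
        [ exact: (rn_wk H) | exact: (rn_wk (rn_wk H))
        | exact: (rn_wk (rn_wk (rn_wk H))) ]
    | H : rb _ _ |- _ => first
        [ exact: (rb_wk H) | exact: (rb_wk (rb_wk H))
        | exact: (rb_wk (rb_wk (rb_wk H))) ]
    end ].

Ltac rn_step := first
  [ rn_leaf
  | match goal with
    | |- rn ?k (fun c => nat_of_bool (@?p c)) => change (rb k p)
    | |- rn ?k (fun c => (@?f c).+1) => apply: (@rn_succ k _ f)
    | |- rn ?k (fun c => (@?f c).-1) => apply: (@rn_pred k _ f)
    | |- rn ?k (fun c => (@?f c)./2) => apply: (@rn_half k _ f)
    | |- rn ?k (fun c => @?f c + @?g c) => apply: (@rn_add k _ f g)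
    | |- rn ?k (fun c => @?f c * @?g c) => apply: (@rn_mul k _ f g)
    | |- rn ?k (fun c => @?f c - @?g c) => apply: (@rn_sub k _ f g)
    | |- rn ?k (fun c => minn (@?f c) (@?g c)) => apply: (@rn_min k _ f g)
    | |- rn ?k (fun c => count (@?P c) (iota 0 (@?f c))) =>
        apply: (@rn_count k _ f P)
    | |- rn ?k (fun c => size (nth [::] _ ?j)) => apply: (@rn_size k _ j)
    | |- rb ?k (fun c => ~~ @?p c) => apply: (@rb_neg k _ p)
    | |- rb ?k (fun c => @?p c && @?q c) => apply: (@rb_and k _ p q)
    | |- rb ?k (fun c => @?p c || @?q c) => apply: (@rb_or k _ p q)
    | |- rb ?k (fun c => @?p c == @?q c :> bool) => apply: (@rb_eqb k _ p q)
    | |- rb ?k (fun c => @?f c == @?g c :> nat) => apply: (@rb_eqn k _ f g)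
    | |- rb ?k (fun c => @?f c <= @?g c) => apply: (@rb_leq k _ f g)
    | |- rb ?k (fun c => odd (@?f c)) => apply: (@rb_odd k _ f)
    | |- rb ?k (fun c => has (@?P c) (iota 0 (@?f c))) => apply: (@rb_has k _ f P)
    | |- rb ?k (fun c => all (@?P c) (iota 0 (@?f c))) => apply: (@rb_all k _ f P)
    | |- rb ?k (fun c => nth false (nth [::] _ ?j) (@?f c)) =>
        apply: (@rb_bit k _ j f)
    end ]; cbv beta.

Ltac rn_tac := repeat rn_step; rewrite //.

Section LayoutRn.
Variable k : nat.
Hypothesis k_gt0 : 0 < k.

(* When [x] contains at position [p] the encoding of a list with items of [w]
   bits, its length: the flags preceding the items are [w.+1] cells apart. *)
Definition llen (x : word) (p w : nat) : nat :=
  iteri (size x) (fun i a => a + ((a == i) && nth false x (p + i * w.+1))) 0.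

Lemma rn_llen (C : ctx) (p w : C -> nat) : rn k p -> rn k w ->
  rn k (fun c => llen (nth [::] (wds c) 0) (p c) (w c)).
Proof.
move=> rp rw.
apply: (@rn_iteri _ C (fun c => size (nth [::] (wds c) 0)) (fun=> 0)
  (fun c => size (nth [::] (wds c) 0))
  (fun c i a => a + ((a == i) && nth false (nth [::] (wds c) 0) (p c + i * (w c).+1)))).
- by rn_tac.
- by rn_tac.
- by rn_tac.
- by apply: pb_le (pb_mu _) => c; apply: size_mu.
move=> c i le_i; apply: leq_trans le_i; elim: i => //= i IH.
by rewrite -[i.+1]addn1 leq_add //; case: (_ && _).
Qed.
End LayoutRn.

(** * Lists, sets and numbers at a position of a word *)


(** The accumulator of [llen] keeps up with the loop index while the flags are set and is frozen at
    the first unset one. *)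
Lemma llen_prop x p w (l := llen x p w) :
  [/\ l <= size x, forall j, j < l -> nth false x (p + j * w.+1)
    & l < size x -> nth false x (p + l * w.+1) = false].
Proof.
rewrite /l /llen; elim: (size x) => //= n [le_n hj hl].
set a := iteri n _ _ in le_n hj hl *.
have [ea|ne] /= := eqVneq a n; last first.
  rewrite addn0; split=> //; first exact: leqW.
  by move=> _; apply: hl; rewrite ltn_neqAle ne.
rewrite ea in le_n hj hl *; case e: nth => /=; rewrite ?addn1 ?addn0.
  split=> // [j|]; last by rewrite ltnn.
  by rewrite ltnS leq_eqVlt => /predU1P[->|/hj].
by split=> //; lia.
Qed.

Lemma llen_eq x p w l : l <= size x ->
  (forall j, j < l -> nth false x (p + j * w.+1)) ->
  nth false x (p + l * w.+1) = false -> llen x p w = l.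
Proof.
move=> le_l hj hl; have [le_a ha ha'] := llen_prop x p w.
have [lt_al|lt_la|//] := ltngtP (llen x p w) l.
  by have := ha' (leq_trans lt_al le_l); rewrite hj.
by have := ha _ lt_la; rewrite hl.
Qed.

Definition lend (x : word) (p w : nat) : nat := p + llen x p w * w.+1 + 1.

Lemma enc_list_map (T : Type) (enc : T -> word) s :
  enc_list enc s = enc_list id (map enc s).
Proof. by rewrite /enc_list -map_comp. Qed.

Lemma enc_list_cons u us : enc_list id (u :: us) = true :: u ++ enc_list id us.
Proof. by rewrite /enc_list /= -catA. Qed.

Lemma nth_at (x : word) p a b q :
  drop p x = a ++ b -> q < size a -> nth false x (p + q) = nth false a q.
Proof. by move=> e lt_q; rewrite -nth_drop e nth_cat lt_q. Qed.

Lemma drop_at (x : word) p a b : drop p x = a ++ b -> drop (p + size a) x = b.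
Proof. by move=> e; rewrite addnC -drop_drop e drop_size_cat. Qed.

Lemma rn_lend k (C : ctx) (p w : C -> nat) : 0 < k -> rn k p -> rn k w ->
  rn k (fun c => lend (nth [::] (wds c) 0) (p c) (w c)).
Proof.
move=> k_gt0 rp rw.
have rl : rn k (fun c => llen (nth [::] (wds c) 0) (p c) (w c)) by apply: rn_llen.
by rewrite /lend; rn_tac.
Qed.

Section ListAt.

Variables (x rest : word) (p w : nat) (us : seq word).
Hypothesis us_w : all (fun u => size u == w) us.
Hypothesis x_us : drop p x = enc_list id us ++ rest.

Lemma list_at j : j <= size us ->
  drop (p + j * w.+1) x = enc_list id (drop j us) ++ rest.
Proof.
elim: us p us_w x_us j => [|u us' IH] q; first by move=> _ e [|j] //; rewrite addn0.
move=> /= /andP[/eqP su hus] e [|j] lt_j; first by rewrite addn0.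
have := @drop_at x q (true :: u) (enc_list id us' ++ rest).
rewrite e /enc_list /= -!catA => /(_ erefl) /=; rewrite su => e'.
have {}e' : drop (q + w.+1) x = enc_list id us' ++ rest.
  by rewrite e' /enc_list -catA.
by have := IH _ hus e' _ lt_j; rewrite mulSn addnA => ->; rewrite /enc_list -catA.
Qed.

Lemma list_end_lt : p + size us * w.+1 < size x.
Proof.
have := list_at (leqnn _); rewrite drop_size => /(congr1 size).
by rewrite size_drop size_cat /=; lia.
Qed.

Lemma list_cons j : j < size us ->
  drop (p + j * w.+1) x = true :: nth [::] us j ++ (enc_list id (drop j.+1 us) ++ rest).
Proof.
move=> lt_j; rewrite (list_at (ltnW lt_j)) (drop_nth [::] lt_j).
by rewrite /enc_list /= -!catA.
Qed.

Lemma list_llen : llen x p w = size us.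
Proof.
apply: llen_eq => [|j lt_j|]; first by have := list_end_lt; nia.
  by rewrite -[p + _]addn0 -nth_drop (list_cons lt_j).
by rewrite -[p + _]addn0 -nth_drop list_at // drop_size.
Qed.

Lemma list_lend : drop (lend x p w) x = rest.
Proof.
rewrite /lend list_llen addnC -drop_drop (list_at (leqnn _)) drop_size /=.
by rewrite drop0.
Qed.

Lemma list_lend_size : lend x p w <= size x.
Proof. by rewrite /lend list_llen addn1 list_end_lt. Qed.

Lemma list_item j q : j < size us -> q < w ->
  nth false x (p + j * w.+1 + 1 + q) = nth false (nth [::] us j) q.
Proof.
move=> lt_j lt_q; have := list_cons lt_j.
rewrite -addnA -nth_drop => ->; rewrite add1n /= nth_cat.
by have /eqP -> := allP us_w _ (mem_nth [::] lt_j); rewrite lt_q.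
Qed.

End ListAt.

(** Converse of reading a given encoding: flags and item length determine the splitting, so it is
    enough that the computed end lies within the word. This is how ill-formed inputs are told
    apart. *)
Lemma list_parse x p w : lend x p w <= size x ->
  exists us, [/\ size us = llen x p w, all (fun u => size u == w) us
    & drop p x = enc_list id us ++ drop (lend x p w) x].
Proof.
rewrite /lend; have [_ + hl] := llen_prop x p w => + le_x.
have {}hl := hl ltac:(nia); move: le_x hl.
move: (llen x p w) => l; elim: l p => [|l IH] p.
  rewrite addn0 addn1 => lt_p hl _; exists [::]; split=> //.
  by rewrite (drop_nth false) // hl.
move=> le_x hl hj.
have [||j lt_j|us [sz_us us_w e]] := IH (p + w.+1).
- by lia.
- by rewrite -hl; congr nth; lia.
- by have := hj j.+1 lt_j; rewrite mulSn addnA.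
exists (take w (drop p.+1 x) :: us); split.
- by rewrite /= sz_us.
- by rewrite /= us_w andbT; apply/eqP/size_takel; rewrite size_drop; lia.
have lt_p : p < size x by lia.
have -> : p + l.+1 * w.+1 + 1 = p + w.+1 + l * w.+1 + 1 by lia.
rewrite enc_list_cons /= -catA -e.
rewrite (drop_nth false) //; have := hj 0 isT; rewrite addn0 => ->.
have -> : drop (p + w.+1) x = drop w (drop p.+1 x) by rewrite drop_drop; congr drop; lia.
by rewrite cat_take_drop.
Qed.

(** * Literals as positions in bit vectors *)

Section LiteralCodes.

Variable n : nat.
Implicit Types (A B : {set lit n}) (l : lit n) (P : pred nat).

(** The two literals of a variable are adjacent in the bit vector of a set, the positive one first;
    halving recovers the variable and parity the sign. *)
Definition code l : nat := 2 * l.1 + ~~ l.2.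

Lemma code_lt l : code l < 2 * n.
Proof. by rewrite /code; have := ltn_ord l.1; case: l.2 => /=; lia. Qed.

Lemma code_half l : (code l)./2 = l.1.
Proof. by rewrite /code mul2n addnC; case: l.2; rewrite /= ?add0n ?add1n ?uphalf_double ?doubleK. Qed.

Lemma code_odd l : odd (code l) = ~~ l.2.
Proof. by rewrite /code oddD mul2n odd_double; case: l.2. Qed.

Lemma code_surj q : q < 2 * n -> exists l, code l = q.
Proof.
move=> lt_q; have lt_h : q./2 < n by lia.
exists (Ordinal lt_h, ~~ odd q); rewrite /code /= negbK.
by rewrite -[RHS]odd_double_half mul2n addnC.
Qed.

Definition lits : seq (lit n) := [seq (i, b) | i <- enum 'I_n, b <- [:: true; false]].

Lemma enc_setE A : enc_set A = [seq l \in A | l <- lits].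
Proof. by rewrite /enc_set /lits map_allpairs. Qed.

Lemma lits_perm : perm_eq lits (enum (lit n)).
Proof.
apply: uniq_perm; last 1 first.
- move=> [i b]; rewrite mem_enum inE; apply/allpairsP.
  by exists (i, b); split; rewrite ?mem_enum //; case: b.
- apply: allpairs_uniq => //; first exact: enum_uniq.
  by move=> [i b] [j d] _ _ [-> ->].
exact: enum_uniq.
Qed.

Lemma count_enc_set A : count id (enc_set A) = #|A|.
Proof.
rewrite enc_setE count_map (permP lits_perm) enumT cardE /enum_mem size_filter.
exact: eq_count.
Qed.

Lemma size_enc_set A : size (enc_set A) = 2 * n.
Proof. by rewrite size_allpairs size_enum_ord mulnC. Qed.

Lemma nth_enc_set A l : nth false (enc_set A) (code l) = (l \in A).
Proof.
case: l => i b; have e (s : seq 'I_n) j c : j < size s ->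
    nth false [seq (i, b) \in A | i <- s, b <- [:: true; false]] (2 * j + ~~ c)
    = ((nth i s j, c) \in A).
  elim: s j => // a s IH [|j] lt_j; first by case: c {IH}.
  by rewrite mulnSr -addnA addnCA addnC /= -IH // addnC.
by rewrite [LHS]e ?size_enum_ord //= nth_ord_enum.
Qed.

Lemma enc_set_surj u : size u = 2 * n -> exists A, enc_set A = u.
Proof.
move=> sz_u; exists [set l | nth false u (code l)].
apply: (@eq_from_nth _ false) => [|q]; first by rewrite size_enc_set.
by rewrite size_enc_set => /code_surj[l <-]; rewrite nth_enc_set inE.
Qed.

(** With [has_code] and [count_code], this translates the loops of the verifier over positions into
    quantifiers and cardinalities over literals. *)
Lemma all_code P : all P (iota 0 (2 * n)) = [forall l : lit n, P (code l)].
Proof.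
apply/allP/forallP => h => [l|q].
  by apply: h; rewrite mem_iota code_lt.
by rewrite mem_iota add0n => /andP[_ /code_surj[l <-]].
Qed.

Lemma has_code P : has P (iota 0 (2 * n)) = [exists l : lit n, P (code l)].
Proof.
apply/hasP/existsP => [[q]|[l Pl]].
  by rewrite mem_iota add0n => /andP[_ /code_surj[l <-]] Pl; exists l.
by exists (code l) => //; rewrite mem_iota code_lt.
Qed.

Lemma count_code P : count P (iota 0 (2 * n)) = #|[set l : lit n | P (code l)]|.
Proof.
rewrite -count_enc_set; set A := [set _ | _].
have -> : enc_set A = [seq P q | q <- iota 0 (2 * n)].
  apply: (@eq_from_nth _ false); first by rewrite size_enc_set size_map size_iota.
  move=> q; rewrite size_enc_set => lt_q.
  rewrite (nth_map 0) ?size_iota // nth_iota //.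
  by have [l <-] := code_surj lt_q; rewrite nth_enc_set inE.
by rewrite count_map; apply: eq_count.
Qed.

End LiteralCodes.

(** * Binary numbers and their truncated values *)

Definition bits_val (u : word) : nat := foldr (fun (b : bool) v => b + 2 * v) 0 u.

(** The most significant digit comes last and is 1; the arbitrary default [b] also makes the word
    nonempty. *)
Lemma bits_of_posP p : bits_val (bits_of_pos p) = nat_of_pos p /\
  forall b, last b (bits_of_pos p).
Proof.
elim: p => [p [IH hl]|p [IH hl]|] //=; split=> //.
- by rewrite IH NatTrec.doubleE; lia.
- by rewrite IH NatTrec.doubleE; lia.
Qed.

Lemma bits_of_natK k : bits_val (bits_of_nat k) = k.
Proof.
rewrite /bits_of_nat -[in RHS](bin_of_natK k); case: bin_of_nat => //= p.
by have [] := bits_of_posP p.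
Qed.

Lemma last_bits_of_nat k : last true (bits_of_nat k).
Proof.
by rewrite /bits_of_nat; case: bin_of_nat => //= p; have [] := bits_of_posP p.
Qed.

(** Canonical binary words are those without a leading zero; the default [true] admits the empty
    word, which codes 0. *)
Lemma bits_of_nat_surj u : last true u -> exists k, bits_of_nat k = u.
Proof.
move=> hl; suff: u = [::] \/ exists p, bits_of_pos p = u.
  case=> [->|[p <-]]; first by exists 0.
  by exists (nat_of_bin (BinNums.Npos p)); rewrite /bits_of_nat nat_of_binK.
elim: u hl => [|b u IH]; first by left.
case: u IH => [|d u] IH /=; first by move=> ->; right; exists BinNums.xH.
move=> /IH[//|[p ep]]; right.
by case: b; [exists (BinNums.xI p) | exists (BinNums.xO p)]; rewrite /= ep.
Qed.


Lemma count_iota_nth (T : Type) (d : T) (P : pred T) s :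
  count (fun j => P (nth d s j)) (iota 0 (size s)) = count P s.
Proof. by rewrite -[in RHS](mkseq_nth d s) count_map. Qed.

Lemma has_iota_nth (T : Type) (d : T) (P : pred T) s :
  has (fun j => P (nth d s j)) (iota 0 (size s)) = has P s.
Proof. by rewrite !has_count count_iota_nth. Qed.

Lemma all_iota_nth (T : Type) (d : T) (P : pred T) s :
  all (fun j => P (nth d s j)) (iota 0 (size s)) = all P s.
Proof. by rewrite !all_count count_iota_nth size_iota. Qed.

Lemma map_surj (A : Type) (f : A -> word) us :
  (forall u, u \in us -> exists a, f a = u) -> exists s, map f s = us.
Proof.
elim: us => [|u us IH] h; first by exists [::].
have [a <-] := h _ (mem_head _ _).
have [v v_us|s <-] := IH; first by apply: h; rewrite inE v_us orbT.
by exists (a :: s).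
Qed.

Lemma nth_flatten_const (us : seq word) w i q :
  all (fun u => size u == w) us -> i < size us -> q < w ->
  nth false (flatten us) (i * w + q) = nth false (nth [::] us i) q.
Proof.
elim: us i => // u us IH [|i] /= /andP[/eqP su hus] lt_i lt_q; rewrite nth_cat su.
  by rewrite lt_q.
have -> : (i.+1 * w + q < w) = false by apply/negbTE; rewrite -leqNgt mulSn; lia.
by rewrite mulSn -addnA addKn IH.
Qed.

Section Numbers.

Variable x : word.

(** Horner evaluation from the most significant digit, truncated at [size x] in every round, since
    the full value may be too large for a unary register. Truncating early is harmless: with [s] for
    the length, [minn s (2 * minn s v + b) = minn s (2 * v + b)]. *)
Definition nval (p : nat) : nat :=
  iteri (llen x p 1)
    (fun i a => minn (size x)
       (2 * a + nth false x (p + (llen x p 1 - i.+1) * 2 + 1))) 0.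

Definition natok (p : nat) : bool :=
  (llen x p 1 == 0) || nth false x (p + (llen x p 1).-1 * 2 + 1).

Lemma bits_at p u rest :
  drop p x = enc_list (fun b : bool => [:: b]) u ++ rest ->
  [/\ llen x p 1 = size u, nval p = minn (size x) (bits_val u)
    & natok p = last true u].
Proof.
rewrite enc_list_map => e; set us := map _ _ in e.
have us_1 : all (fun v => size v == 1) us by rewrite all_map; apply/allP.
have sz : llen x p 1 = size u by rewrite (list_llen us_1 e) size_map.
have bit j : j < size u -> nth false x (p + j * 2 + 1) = nth false u j.
  move=> lt_j; have := list_item us_1 e (j := j) (q := 0).
  by rewrite size_map addn0 => ->; rewrite // (nth_map false).
split=> //; last first.
  rewrite /natok sz; have [/size0nil -> //|u_gt0] := posnP (size u).
  rewrite /= bit ?prednK // -nth_last.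
  by apply: set_nth_default; rewrite prednK.
rewrite /nval sz.
suff h i : i <= size u -> iteri i (fun i a => minn (size x)
    (2 * a + nth false x (p + (size u - i.+1) * 2 + 1))) 0 =
    minn (size x) (bits_val (drop (size u - i) u)).
  by rewrite h // subnn drop0.
elim: i => [|i IH] lt_i; first by rewrite subn0 drop_size /= minn0.
rewrite iteriS IH ?(ltnW lt_i) // bit; last by lia.
rewrite (drop_nth false (n := size u - i.+1)); last by lia.
have -> : (size u - i.+1).+1 = size u - i by lia.
by rewrite /=; set v := bits_val _; case: nth => /=; lia.
Qed.

Lemma nat_at p j rest : drop p x = enc_nat j ++ rest ->
  [/\ drop (lend x p 1) x = rest, lend x p 1 <= size x,
      nval p = minn (size x) j & natok p].
Proof.
move=> e; have [_ -> ->] := bits_at e; rewrite bits_of_natK last_bits_of_nat.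
rewrite /enc_nat enc_list_map in e.
have us_1 : all (fun v => size v == 1)
  (map (fun b : bool => [:: b]) (bits_of_nat j)) by rewrite all_map; apply/allP.
by split=> //; [apply: list_lend e | apply: list_lend_size e].
Qed.

Lemma nat_parse p : lend x p 1 <= size x -> natok p ->
  exists j, drop p x = enc_nat j ++ drop (lend x p 1) x.
Proof.
move=> le_x ok; have [us [_ us_1 e]] := list_parse le_x.
have [u eu] : exists u, map (fun b : bool => [:: b]) u = us.
  by apply: map_surj => v /(allP us_1); case: v => // b [] // _; exists b.
have {}e : drop p x =
    enc_list (fun b : bool => [:: b]) u ++ drop (lend x p 1) x.
  by rewrite enc_list_map eu.
have [_ _] := bits_at e; rewrite ok => /esym/bits_of_nat_surj[j ej].
by exists j; rewrite /enc_nat ej.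
Qed.

End Numbers.

Lemma rn_nval k (C : ctx) (p : C -> nat) : 0 < k -> rn k p ->
  rn k (fun c => nval (nth [::] (wds c) 0) (p c)).
Proof.
move=> k_gt0 rp; have r1 := rn_const k C 1.
have rl : rn k (fun c => llen (nth [::] (wds c) 0) (p c) 1) by apply: rn_llen.
apply: (@rn_iteri _ C _ (fun=> 0) (fun c => size (nth [::] (wds c) 0))
  (fun c i a => minn (size (nth [::] (wds c) 0))
     (2 * a + nth false (nth [::] (wds c) 0)
       (p c + (llen (nth [::] (wds c) 0) (p c) 1 - i.+1) * 2 + 1)))) => //.
- by rn_tac.
- by rn_tac.
- by apply: pb_le (pb_mu _) => c; apply: size_mu.
by move=> c [|i] _ //=; apply: geq_minl.
Qed.

Lemma rb_natok k (C : ctx) (p : C -> nat) : 0 < k -> rn k p ->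
  rb k (fun c => natok (nth [::] (wds c) 0) (p c)).
Proof.
move=> k_gt0 rp; have r1 := rn_const k C 1.
have rl : rn k (fun c => llen (nth [::] (wds c) 0) (p c) 1) by apply: rn_llen.
by rewrite /natok; rn_tac.
Qed.

Section SetsAt.

Variables (n : nat) (x : word).

Lemma set_at p (A : {set lit n}) rest : drop p x = enc_set A ++ rest ->
  drop (p + 2 * n) x = rest /\ forall l, nth false x (p + code l) = (l \in A).
Proof.
move=> e; split=> [|l]; first by have := drop_at e; rewrite size_enc_set.
by rewrite (nth_at e) ?nth_enc_set // size_enc_set code_lt.
Qed.

Lemma set_parse p : p + 2 * n <= size x ->
  exists A : {set lit n}, drop p x = enc_set A ++ drop (p + 2 * n) x.
Proof.
move=> le_x; have [|A eA] := @enc_set_surj n (take (2 * n) (drop p x)).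
  by rewrite size_takel // size_drop; lia.
by exists A; rewrite eA addnC -drop_drop cat_take_drop.
Qed.

Lemma sets_parse p : lend x p (2 * n) <= size x ->
  exists s : seq {set lit n},
    drop p x = enc_list (@enc_set n) s ++ drop (lend x p (2 * n)) x.
Proof.
move=> /list_parse[us [_ us_w e]].
have [s es] : exists s, map (@enc_set n) s = us.
  by apply: map_surj => u /(allP us_w)/eqP/enc_set_surj.
by exists s; rewrite enc_list_map es.
Qed.

Lemma pairs_parse p : lend x p (4 * n) <= size x ->
  exists s : seq ({set lit n} * {set lit n}),
    drop p x = enc_list (fun p => enc_set p.1 ++ enc_set p.2) s
               ++ drop (lend x p (4 * n)) x.
Proof.
move=> /list_parse[us [_ us_w e]].
pose f (p : {set lit n} * {set lit n}) := enc_set p.1 ++ enc_set p.2.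
have [s es] : exists s, map f s = us.
  apply: map_surj => u /(allP us_w)/eqP su.
  have [|A eA] := @enc_set_surj n (take (2 * n) u).
    by rewrite size_takel // su; lia.
  have [|B eB] := @enc_set_surj n (drop (2 * n) u).
    by rewrite size_drop su; lia.
  by exists (A, B); rewrite /f /= eA eB cat_take_drop.
by exists s; rewrite enc_list_map es.
Qed.

End SetsAt.

(** * Reading and decoding xor-dependency scenarios *)

Section Xor.

Variables (x : word) (n p : nat).

Definition xor_next : nat := lend x (p + 2 * n) (4 * n).

Definition xor_len : nat := llen x (p + 2 * n) (4 * n).

Definition xor_pos (j : nat) : nat := p + 2 * n + j * (4 * n).+1 + 1.

Definition xor_ok : bool :=
  all (fun q => nth false x (p + q)
         + count (fun j => nth false x (xor_pos j + q)) (iota 0 xor_len)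
         + count (fun j => nth false x (xor_pos j + (2 * n + q))) (iota 0 xor_len)
         <= 1) (iota 0 (2 * n)).

(** The second set of a pair is stored [2 * n] cells after the first, so an unset choice bit becomes
    an additional offset. *)
Definition xor_sig (y : word) (q : nat) : bool :=
  nth false x (p + q) ||
  has (fun j => nth false x (xor_pos j + (~~ nth false y j * (2 * n) + q)))
    (iota 0 xor_len).

End Xor.

Definition xor_dec n (X : xor_set n) (y : word) : {set lit n} :=
  xor_core X :|: \bigcup_(i < size (xor_pairs X))
      let: p := tnth (in_tuple (xor_pairs X)) i in
      if nth false y i then p.1 else p.2.

Lemma xor_dec_scenario n (X : xor_set n) y : xor_scenario X (xor_dec X y).
Proof. by exists (fun i => nth false y i). Qed.

Lemma size_enc_list_ge (T : Type) (enc : T -> word) s : size s <= size (enc_list enc s).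
Proof.
rewrite /enc_list size_cat; apply: leq_trans (leq_addr _ _).
by elim: s => //= a s IH; rewrite size_cat; lia.
Qed.

Lemma xor_scenario_dec n (X : xor_set n) sigma : xor_scenario X sigma ->
  exists2 y, size y <= size (enc_xor X) & xor_dec X y = sigma.
Proof.
case=> ch ->; exists [seq ch i | i <- enum 'I_(size (xor_pairs X))].
  rewrite size_map size_enum_ord size_cat.
  exact: leq_trans (size_enc_list_ge _ _) (leq_addl _ _).
congr (_ :|: _); apply: eq_bigr => i _.
by rewrite (nth_map i) ?size_enum_ord // nth_ord_enum.
Qed.

(** Turns disjointness into a count for each element, the form evaluated by [xor_ok]. Entries of the
    list are counted, so a repeated nonempty set is a violation, as it must be. *)
Lemma pairwise_disjointP (T : finType) (s : seq {set T}) :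
  pairwise (fun A B : {set T} => [disjoint A & B]) s =
  [forall l, count (fun A : {set T} => l \in A) s <= 1].
Proof.
elim: s => [|A s IH]; first by apply/esym/forallP.
rewrite pairwise_cons IH; apply/andP/forallP => [[/allP hA /forallP hs] l|h].
  have := hs l; rewrite /=; case lA: (l \in A) => // _.
  have -> : count (fun A : {set T} => l \in A) s = 0 => //.
  apply/eqP; rewrite -leqn0 leqNgt -has_count; apply/hasPn => B Bs.
  by have /disjointFr -> := hA _ Bs.
split; last by apply/forallP => l; have := h l; rewrite /=; lia.
apply/allP => B Bs; rewrite disjoint_subset; apply/subsetP => l lA.
rewrite inE; apply/negP => lB; have := h l; rewrite /= lA.
have : has (fun A : {set T} => l \in A) s by apply/hasP; exists B.
by rewrite has_count; lia.
Qed.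

Lemma xor_at n (X : xor_set n) x p rest : drop p x = enc_xor X ++ rest ->
  [/\ drop (xor_next x n p) x = rest, xor_next x n p <= size x,
      xor_ok x n p = xor_wf X
    & forall y l, xor_sig x n p y (code l) = (l \in xor_dec X y)].
Proof.
rewrite -catA => /set_at[e core].
rewrite enc_list_map in e; set us := map _ _ in e.
have us_w : all (fun u => size u == 4 * n) us.
  rewrite all_map; apply/allP => A _ /=; rewrite size_cat !size_enc_set.
  by apply/eqP; lia.
have sz : xor_len x n p = size (xor_pairs X).
  by rewrite /xor_len (list_llen us_w e) size_map.
have item (b : bool) j l : j < size (xor_pairs X) ->
    nth false x (xor_pos n p j + (b * (2 * n) + code l)) =
    (l \in let A := nth (set0, set0) (xor_pairs X) j in if b then A.2 else A.1).
  move=> lt_j; have lt_l := code_lt l.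
  rewrite (list_item us_w e) ?size_map //; last by case: b; lia.
  rewrite (nth_map (set0, set0)) // nth_cat size_enc_set.
  case: b => /=; rewrite ?mul0n ?mul1n ?add0n ?lt_l ?nth_enc_set //.
  by rewrite ltnNge leq_addr /= addKn nth_enc_set.
split; [exact: list_lend e | exact: list_lend_size e| |].
  rewrite /xor_ok all_code /xor_wf pairwise_disjointP; apply: eq_forallb => l.
  rewrite core /= sz -addnA; congr (_ + _ <= 1).
  pose in1 (A : {set lit n} * {set lit n}) := l \in A.1.
  pose in2 (A : {set lit n} * {set lit n}) := l \in A.2.
  transitivity (count in1 (xor_pairs X) + count in2 (xor_pairs X)).
    rewrite -(count_iota_nth (set0, set0) in1).
    rewrite -(count_iota_nth (set0, set0) in2); congr (_ + _).
      apply: eq_in_count => j; rewrite mem_iota => /andP[_ lt_j].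
      by have := item false j l lt_j; rewrite mul0n.
    apply: eq_in_count => j; rewrite mem_iota => /andP[_ lt_j].
    by have := item true j l lt_j; rewrite mul1n.
  by elim: (xor_pairs X) => //= A s <-; rewrite /in1 /in2; lia.
move=> y l; rewrite /xor_sig core in_setU sz; congr (_ || _).
apply/hasP/bigcupP => [[j]|[i _]].
  rewrite mem_iota => /andP[_ lt_j]; rewrite item // => h.
  exists (Ordinal lt_j) => //; rewrite (tnth_nth (set0, set0)) /=.
  by case: (nth false y j) h.
rewrite (tnth_nth (set0, set0)) => h; exists (val i).
  by rewrite mem_iota ltn_ord.
by rewrite item //=; case: (nth false y i) h.
Qed.

Lemma xor_parse n x p : xor_next x n p <= size x ->
  exists X : xor_set n, drop p x = enc_xor X ++ drop (xor_next x n p) x.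
Proof.
move=> le_x; have [s es] := pairs_parse le_x.
have [|A eA] := @set_parse n x p.
  by apply: leq_trans le_x; rewrite /xor_next /lend; lia.
by exists (XorSet A s); rewrite eA es /enc_xor /= catA.
Qed.

(** * Reading and decoding Gamma-set scenarios *)

Section Gamma.

Variables (x : word) (n p : nat).

Definition gamma_mid : nat := lend x (p + 2 * n) (2 * n).

Definition gamma_next : nat := lend x gamma_mid 1.

Definition gamma_len : nat := llen x (p + 2 * n) (2 * n).

Definition gamma_pos (j : nat) : nat := p + 2 * n + j * (2 * n).+1 + 1.

(* Only the first [Gamma] sets selected by [y] are activated, so that every
   word denotes a scenario. *)
Definition gamma_sig (y : word) (q : nat) : bool :=
  nth false x (p + q) ||
  has (fun j => (nth false y j &&
                 (count (nth false y) (iota 0 j) < nval x gamma_mid)) &&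
                nth false x (gamma_pos j + q)) (iota 0 gamma_len).

End Gamma.

Definition selected (y : word) (g j : nat) : bool :=
  nth false y j && (count (nth false y) (iota 0 j) < g).

Definition gamma_dec n (G : gamma_set n) (y : word) : {set lit n} :=
  gamma_core G :|: \bigcup_(j < size (gamma_sets G) | selected y (gamma_bound G) j)
    nth set0 (gamma_sets G) j.

(** Used to bound by [g] the number of sets that an arbitrary word activates. *)
Lemma count_selected y g k :
  count (selected y g) (iota 0 k) = minn g (count (nth false y) (iota 0 k)).
Proof.
elim: k => [|k IH]; first by rewrite minn0.
rewrite -addn1 iotaD !count_cat IH /= !addn0 add0n /selected.
by case: (nth false y k) => /=; lia.
Qed.

Lemma gamma_dec_scenario n (G : gamma_set n) y :
  gamma_scenario G (gamma_dec G y).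
Proof.
pose s := [seq nth set0 (gamma_sets G) j |
  j <- iota 0 (size (gamma_sets G)) & selected y (gamma_bound G) j].
exists [set A in s]; split.
- move=> A; rewrite inE => /mapP[j]; rewrite mem_filter mem_iota.
  by move=> /and3P[_ _ lt_j] ->; apply: mem_nth.
- rewrite cardsE; apply: leq_trans (card_size _) _.
  by rewrite size_map size_filter count_selected geq_minl.
congr (_ :|: _); apply/setP => l; apply/bigcupP/bigcupP => [[j hj lj]|[A]].
  exists (nth set0 (gamma_sets G) j) => //; rewrite inE; apply/mapP.
  by exists (val j) => //; rewrite mem_filter hj mem_iota ltn_ord.
rewrite inE => /mapP[j]; rewrite mem_filter mem_iota => /and3P[hj _ lt_j] -> lA.
by exists (Ordinal lt_j).
Qed.

Lemma gamma_scenario_dec n (G : gamma_set n) sigma : gamma_scenario G sigma ->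
  exists2 y, size y <= size (enc_gamma G) & gamma_dec G y = sigma.
Proof.
case=> Es [sub card_Es ->]; set s := gamma_sets G.
(* The list may repeat a set, whereas [Es] counts it once; choosing only the first occurrence of
   each member keeps the number of chosen positions within the bound. *)
pose b j := (nth set0 s j \in Es) && (index (nth set0 s j) s == j).
exists (mkseq b (size s)).
  rewrite size_mkseq size_cat [X in _ + X]size_cat.
  apply: leq_trans (leq_addl _ _).
  exact: leq_trans (size_enc_list_ge _ _) (leq_addr _ _).
set y := mkseq _ _.
have yE j : nth false y j = (j < size s) && b j.
  have [lt_j|le_j] := ltnP j (size s); first by rewrite nth_mkseq.
  by rewrite nth_default // size_mkseq.
have cnt j : count (nth false y) (iota 0 j) <= #|Es|.
  rewrite -size_filter -(size_map (nth set0 s)).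
  rewrite cardE; apply: uniq_leq_size.
    rewrite map_inj_in_uniq; first exact/filter_uniq/iota_uniq.
    move=> i i'; rewrite !mem_filter !yE.
    move=> /andP[/and3P[_ _ /eqP ei] _] /andP[/and3P[_ _ /eqP ei'] _] e.
    by rewrite -ei -ei' e.
  move=> A /mapP[i]; rewrite mem_filter yE => /andP[/and3P[_ hi _] _] ->.
  by rewrite mem_enum.
(* At most [#|Es|] positions are chosen in all, so the cut-off of [selected] never takes effect
   here. *)
have sel j : selected y (gamma_bound G) j = nth false y j.
  rewrite /selected; case e: nth => //=; apply: leq_trans card_Es.
  by have := cnt j.+1; rewrite -addn1 iotaD count_cat /= add0n e addn0 addn1.
congr (_ :|: _); apply/setP => l; apply/bigcupP/bigcupP => [[j]|[A AE lA]].
  by rewrite sel yE => /and3P[_ hj _] lj; exists (nth set0 s j).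
have As := sub _ AE; have lt_i : index A s < size s by rewrite index_mem.
exists (Ordinal lt_i); rewrite /= ?nth_index //.
by rewrite sel yE lt_i /b nth_index // AE eqxx.
Qed.

Lemma gamma_at n (G : gamma_set n) x p rest : drop p x = enc_gamma G ++ rest ->
  [/\ drop (gamma_next x n p) x = rest, gamma_next x n p <= size x,
      natok x (gamma_mid x n p)
    & forall y l, gamma_sig x n p y (code l) = (l \in gamma_dec G y)].
Proof.
rewrite -2!catA => /set_at[e core].
rewrite enc_list_map in e; set us := map _ _ in e.
have us_w : all (fun u => size u == 2 * n) us.
  by rewrite all_map; apply/allP => A _ /=; rewrite size_enc_set.
have sz : gamma_len x n p = size (gamma_sets G).
  by rewrite /gamma_len (list_llen us_w e) size_map.
have [e1 e2 e3 e4] := nat_at (list_lend us_w e).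
split=> // y l; rewrite /gamma_sig core in_setU sz; congr (_ || _).
have item j : j < size (gamma_sets G) ->
    nth false x (gamma_pos n p j + code l) = (l \in nth set0 (gamma_sets G) j).
  move=> lt_j; rewrite (list_item us_w e) ?size_map ?code_lt //.
  by rewrite (nth_map set0) // nth_enc_set.
(* The count is at most [j], hence less than the length of the input, so comparing it with the
   truncated bound gives the same answer as comparing it with the bound itself. *)
have sel j : j < size (gamma_sets G) ->
    nth false y j && (count (nth false y) (iota 0 j) < nval x (gamma_mid x n p))
    = selected y (gamma_bound G) j.
  move=> lt_j; rewrite /selected e3; congr (_ && _); rewrite leq_min.
  rewrite andb_idl // => _; apply: leq_ltn_trans (count_size _ _) _.
  rewrite size_iota; apply: leq_trans lt_j _.
  have := list_end_lt us_w e; rewrite size_map; nia.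
apply/hasP/bigcupP => [[j]|[i]].
  rewrite mem_iota => /andP[_ lt_j]; rewrite sel // item // => /andP[hj lj].
  by exists (Ordinal lt_j).
move=> hi li; exists (val i); first by rewrite mem_iota ltn_ord.
rewrite sel //=; first by rewrite item // hi.
Qed.

Lemma gamma_parse n x p : gamma_next x n p <= size x -> natok x (gamma_mid x n p) ->
  exists G : gamma_set n, drop p x = enc_gamma G ++ drop (gamma_next x n p) x.
Proof.
move=> le_x ok; have [g eg] := nat_parse le_x ok.
have le_mid : gamma_mid x n p <= size x.
  by apply: leq_trans le_x; rewrite /gamma_next; set q := gamma_mid _ _ _; rewrite /lend; lia.
have [s es] := sets_parse le_mid.
have [|A eA] := @set_parse n x p.
  by apply: leq_trans le_mid; rewrite /gamma_mid /lend; lia.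
by exists (GammaSet A s g); rewrite eA es eg /enc_gamma /= -!catA.
Qed.

(** * The verifier *)


(** The matrices need to agree only on lists of the final length that extend [pre], which is where
    facts about the words already chosen can be used. *)
Lemma alternation_ext ex j B (R R' : seq word -> Prop) pre :
  (forall ws, size ws = size pre + j -> take (size pre) ws = pre -> (R ws <-> R' ws)) ->
  (alternation ex j B R pre <-> alternation ex j B R' pre).
Proof.
elim: j ex pre => [|j IH] ex pre h /=.
  by apply: h; rewrite ?addn0 ?take_size.
have {}IH b y : alternation b j B R (rcons pre y) <-> alternation b j B R' (rcons pre y).
  apply: IH => ws; rewrite size_rcons => sz tk; apply: h; first by rewrite sz addSnnS.
  by rewrite -(take_takel _ (leqnSn _)) tk -cats1 take_size_cat.
case: ex; first by split=> -[y sy hy]; exists y => //; apply/IH.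
by split=> h' y sy; apply/IH/h'.
Qed.

Lemma alternation_and ex j B (a : Prop) (R : seq word -> Prop) pre :
  alternation ex j B (fun ws => a /\ R ws) pre <-> a /\ alternation ex j B R pre.
Proof.
elim: j ex pre => [|j IH] ex pre //=; case: ex.
  split=> [[y sy /IH[ha h]]|[ha [y sy h]]]; first by split=> //; exists y.
  by exists y => //; apply/IH.
split=> [h|[ha h] y sy]; last by apply/IH; split=> //; apply: h.
by split=> [|y /h/IH[]//]; have /IH[] := h [::] (leq0n _).
Qed.

(** * The game over an abstract kind of scenario sets *)

Section Verifier.

(** The interface shared by both kinds: [decS] sends every word to a scenario and reaches each one
    by a word no longer than the encoding, [sigp] evaluates it directly on the input, [nextp] is the
    position after an encoding and [okp] the check that one is there. *)
Variables (S : nat -> Type) (scen : forall n, S n -> {set lit n} -> Prop).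
Variables (encS : forall n, S n -> word) (wfS : forall n, S n -> bool).
Variable decS : forall n, S n -> word -> {set lit n}.
Variables (nextp : word -> nat -> nat -> nat) (okp : word -> nat -> nat -> bool).
Variable sigp : word -> nat -> nat -> word -> nat -> bool.

Hypothesis dec_scen : forall n (X : S n) y, scen X (decS X y).
Hypothesis scen_dec : forall n (X : S n) sigma, scen X sigma ->
  exists2 y, size y <= size (encS X) & decS X y = sigma.
Hypothesis S_at : forall n (X : S n) x p rest, drop p x = encS X ++ rest ->
  [/\ drop (nextp x n p) x = rest, nextp x n p <= size x, okp x n p = wfS X
    & forall y l, sigp x n p y (code l) = (l \in decS X y)].
Hypothesis S_parse : forall n x p, nextp x n p <= size x -> okp x n p ->
  exists X : S n, drop p x = encS X ++ drop (nextp x n p) x.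
Hypothesis nextp_ge : forall x n p, p <= nextp x n p.

Section Positions.

Variable x : word.

(** A unary number closed by [false] is a list of items of length 0, so the list reader applies.
    Likewise [6 * pnum] below is the length of a clause, three bit vectors of length [2 * pnum]. *)
Definition pnum : nat := llen x 0 0.
Definition pclauses : nat := lend x 0 0.
Definition nclauses : nat := llen x pclauses (6 * pnum).
Definition pclause (j : nat) : nat := pclauses + j * (6 * pnum).+1 + 1.
Definition pbase : nat := lend x pclauses (6 * pnum).
Definition pkappa : nat := pbase + 2 * pnum.

Fixpoint pstage (t : nat) : nat :=
  if t is t'.+1 then nextp x pnum (pstage t') else lend x pkappa 1.

Definition clauses_ok : bool :=
  all (fun j => all (fun i =>
      count (fun q => nth false x (pclause j + (i * (2 * pnum) + q)))
        (iota 0 (2 * pnum)) == 1) (iota 0 3)) (iota 0 nclauses).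

(** Positions never decrease from one part to the next, so the single equation for the end of the
    last stage confines all parts to the input. *)
Definition layout_ok (m : nat) : bool :=
  clauses_ok && natok x pkappa &&
  all (fun t => okp x pnum (pstage t)) (iota 0 m) && (pstage m == size x).

Definition satp (P : nat -> bool) : bool :=
  all (fun j => has (fun i => has (fun q =>
      nth false x (pclause j + (i * (2 * pnum) + q)) && P q)
    (iota 0 (2 * pnum))) (iota 0 3)) (iota 0 nclauses).

Definition distp (P P' : nat -> bool) : bool :=
  count (fun q => ~~ (P q == P' q)) (iota 0 (2 * pnum)) <= nval x pkappa.

Definition active (ws : seq word) (t q : nat) : bool :=
  if t is t'.+1 then sigp x pnum (pstage t') (nth [::] ws (2 * t)) q
  else nth false x (pbase + q).

(* The solution of stage [t]: the word [2 t] selects the scenario and the word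
   [2 t + 1] is the assignment. *)
Definition solp (ws : seq word) (t q : nat) : bool :=
  active ws t q && (nth false (nth [::] ws (2 * t + 1)) q./2 == ~~ odd q).

(** Stated for the [j] stages after [t], so that an induction can peel off one stage at a time. *)
Definition playp (t j : nat) (ws : seq word) : bool :=
  all (fun u => satp (solp ws u)) (iota t.+1 j) &&
  all (fun u => distp (solp ws u) (solp ws u.+1)) (iota t j).

End Positions.

(** Later moves do not affect stage [t]; this lets its conditions leave the scope of the later
    quantifiers. *)
Lemma solp_eq x ws ws' t : take (2 * t + 2) ws = take (2 * t + 2) ws' ->
  solp x ws t = solp x ws' t.
Proof.
move=> e.
have en i : i < 2 * t + 2 -> nth [::] ws i = nth [::] ws' i.
  by move=> lt_i; rewrite -(nth_take _ lt_i) e nth_take.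
apply: functional_extensionality => q; rewrite /solp en; last by lia.
by congr (_ && _); case: t e en => //= t e en; rewrite en //; lia.
Qed.

(** * Correctness of the verifier on an encoded instance *)

Section Instance.

Variables (n : nat) (cs : seq (clause n)) (b : {set lit n}) (kap : nat).
Variables (Xs : seq (S n)) (x : word).
Hypothesis x_def : x = nseq n true ++ false :: enc_list (@enc_clause n) cs ++
  enc_set b ++ enc_nat kap ++ flatten [seq encS X | X <- Xs].

Let word0 : drop 0 x = enc_list id (nseq n [::]) ++
  enc_list (@enc_clause n) cs ++
  enc_set b ++ enc_nat kap ++ flatten [seq encS X | X <- Xs].
Proof.
rewrite drop0 x_def /enc_list -[in RHS]catA; congr (_ ++ _).
by elim: n => //= k ->.
Qed.

Let words0 : all (fun u : word => size u == 0) (nseq n [::]).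
Proof. by rewrite all_nseq orbT. Qed.

Lemma pnumE : pnum x = n.
Proof. by rewrite /pnum (list_llen words0 word0) size_nseq. Qed.

Let cls : seq word := [seq enc_clause C | C <- cs].

Let size_cls : all (fun u => size u == 6 * n) cls.
Proof.
rewrite all_map; apply/allP => C _ /=.
rewrite /enc_clause; case: C => [[|l1 [|l2 [|l3 []]]] //= _].
by rewrite !size_cat !size_enc_set /=; apply/eqP; lia.
Qed.

Let clauses_at : drop (pclauses x) x = enc_list id cls ++
  enc_set b ++ enc_nat kap ++ flatten [seq encS X | X <- Xs].
Proof. by rewrite /pclauses (list_lend words0 word0) enc_list_map. Qed.

Lemma nclausesE : nclauses x = size cs.
Proof. by rewrite /nclauses pnumE (list_llen size_cls clauses_at) size_map. Qed.

Let base_at : drop (pbase x) x = 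
  enc_set b ++ enc_nat kap ++ flatten [seq encS X | X <- Xs].
Proof. by rewrite /pbase pnumE (list_lend size_cls clauses_at). Qed.

Lemma nth_base l : nth false x (pbase x + code l) = (l \in b).
Proof. by have [_ ->] := set_at base_at. Qed.

Let kappa_at : drop (pkappa x) x =
  enc_nat kap ++ flatten [seq encS X | X <- Xs].
Proof. by have [e _] := set_at base_at; rewrite /pkappa pnumE. Qed.

Lemma stage_at t : t <= size Xs ->
  drop (pstage x t) x = flatten [seq encS X | X <- drop t Xs] /\
  pstage x t <= size x.
Proof.
elim: t => [|t IH] lt_t /=.
  by have [e1 e2 _ _] := nat_at kappa_at; rewrite drop0.
have [e _] := IH (ltnW lt_t); rewrite pnumE.
case eX: (drop t Xs) => [|X Xs'] in e.
  by move/(congr1 size): eX; rewrite size_drop /=; lia.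
have [e1 e2 _ _] := S_at e; split=> //; rewrite e1.
by rewrite -add1n -drop_drop eX /= drop0.
Qed.

Lemma stage_cons t X Xs' : drop t Xs = X :: Xs' ->
  okp x n (pstage x t) = wfS X /\
  forall y l, sigp x n (pstage x t) y (code l) = (l \in decS X y).
Proof.
move=> eX; have [|e _] := @stage_at t.
  by rewrite leqNgt; apply/negP => lt_t; move: eX; rewrite drop_oversize // ltnW.
by rewrite eX in e; have [_ _ h1 h2] := S_at e.
Qed.

Lemma nth_clause (l0 : lit n) C0 j i l : j < size cs -> i < 3 ->
  nth false x (pclause x j + (i * (2 * n) + code l)) =
  (l == nth l0 (nth C0 cs j) i).
Proof.
move=> lt_j lt_i; have lt_l := code_lt l; rewrite /pclause pnumE.
rewrite (list_item size_cls clauses_at) ?size_map //; last by nia.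
rewrite (nth_map C0) // /enc_clause (nth_flatten_const (w := 2 * n)) //.
- by rewrite (nth_map l0) ?size_tuple // nth_enc_set in_set1.
- by rewrite all_map; apply/allP => ? _ /=; rewrite size_enc_set.
by rewrite size_map size_tuple.
Qed.

Lemma clauses_okE : clauses_ok x.
Proof.
apply/allP => j; rewrite mem_iota nclausesE pnumE => /andP[_ lt_j].
apply/allP => i; rewrite mem_iota => /andP[_ lt_i].
(* An existing clause provides the default values of [nth], since [lit n] is empty for [n = 0]. *)
have [C0 _] : exists C, C = tnth (in_tuple cs) (Ordinal lt_j) by eexists.
pose l0 := thead C0.
rewrite count_code (_ : [set _ | _] = [set nth l0 (nth C0 cs j) i]) ?cards1 //.
by apply/setP => l; rewrite inE (nth_clause l0 C0) // in_set1.
Qed.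

Lemma satpE P (Q : pred (lit n)) : (forall l, P (code l) = Q l) ->
  satp x P = all (has Q) [seq tval C | C <- cs].
Proof.
move=> PQ; rewrite /satp nclausesE pnumE all_map.
have [->|[C0 _]] : cs = [::] \/ exists C, C \in cs.
- by case: cs => [|C s]; [left | right; exists C; rewrite inE eqxx].
- by [].
pose l0 := thead C0; rewrite -(all_iota_nth C0).
apply: eq_in_all => j; rewrite mem_iota => /andP[_ lt_j].
rewrite -[RHS]/(has Q (nth C0 cs j)) -(has_iota_nth l0) size_tuple; apply: eq_in_has => i.
rewrite mem_iota => /andP[_ lt_i]; rewrite has_code.
apply/existsP/idP => [[l]|Ql].
  by rewrite (nth_clause l0 C0) // PQ => /andP[/eqP <-].
exists (nth l0 (nth C0 cs j) i).
by rewrite (nth_clause l0 C0) // eqxx PQ.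
Qed.

(** Truncating [kap] is harmless: a symmetric difference has at most [2 * n] elements, and the bit
    vector of the base scenario alone is that long. *)
Lemma distpE P P' (s s' : {set lit n}) :
  (forall l, P (code l) = (l \in s)) -> (forall l, P' (code l) = (l \in s')) ->
  distp x P P' = (#|symdiff s s'| <= kap).
Proof.
move=> Ps Ps'; rewrite /distp pnumE count_code.
have -> : [set l | ~~ (P (code l) == P' (code l))] = symdiff s s'.
  by apply/setP => l; rewrite !inE Ps Ps'; case: (l \in s); case: (l \in s').
have [_ _ -> _] := nat_at kappa_at; rewrite leq_min andb_idl // => _.
have := max_card (mem (symdiff s s')); rewrite card_prod card_ord card_bool.
move/leq_trans; apply; have := congr1 size base_at.
by rewrite size_drop size_cat size_enc_set; lia.
Qed.

Lemma sat_solutionP sigma s : sat_solution cs sigma s <->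
  exists2 y, size y <= n &
    all (has (fun l : lit n => (l \in sigma) && (nth false y l.1 == l.2)))
      [seq tval C | C <- cs] /\
    s = [set l in sigma | nth false y l.1 == l.2].
Proof.
have e (a : 'I_n -> bool) (C : clause n) :
    has (fun l => a l.1 == l.2) [seq l <- C | l \in sigma] =
    has (fun l : lit n => (l \in sigma) && (a l.1 == l.2)) C.
  by rewrite !has_count count_filter; congr (0 < _); apply: eq_count => l /=; rewrite andbC.
split=> [[a sat ->]|[y sy [sat ->]]].
  exists [seq a i | i <- enum 'I_n]; first by rewrite size_map size_enum_ord.
  have ay (i : 'I_n) : nth false [seq a i | i <- enum 'I_n] i = a i.
    by rewrite (nth_map i) ?size_enum_ord // nth_ord_enum.
  split; last by apply/setP => l; rewrite !inE ay.
  rewrite all_map; apply: sub_all sat => C; rewrite e /=.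
  by apply: sub_has => l; rewrite ay.
exists (fun i => nth false y i) => //.
by move: sat; rewrite all_map; apply: sub_all => C; rewrite (e (fun i => nth false y i)).
Qed.

Lemma solpE (sigma : {set lit n}) ws t :
  (forall l, active x ws t (code l) = (l \in sigma)) ->
  forall l, solp x ws t (code l) =
    (l \in sigma) && (nth false (nth [::] ws (2 * t + 1)) l.1 == l.2).
Proof. by move=> h l; rewrite /solp h code_half code_odd negbK. Qed.

Lemma layout_okE : layout_ok x (size Xs) = all (@wfS n) Xs.
Proof.
have [_ _ _ ok] := nat_at kappa_at; rewrite /layout_ok clauses_okE ok /=.
have [] := stage_at (leqnn _); rewrite drop_size => /(congr1 size).
rewrite size_drop /= => ge_x le_x.
have -> : pstage x (size Xs) == size x by apply/eqP; lia.
rewrite andbT pnumE -[LHS]/(all _ _).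
case eXs: Xs => [|X0 Xs'] //; rewrite -eXs -(all_iota_nth X0).
apply: eq_in_all => t; rewrite mem_iota => /andP[_ lt_t].
by have [-> _] := stage_cons (drop_nth X0 lt_t).
Qed.

Variable B : nat.
Hypothesis B_ge : size x <= B.

Let n_le_B : n <= B.
Proof. by apply: leq_trans B_ge; rewrite x_def size_cat size_nseq leq_addr. Qed.

(** Induction on the number of stages left. The list [pre] consists of the input and the moves
    through stage [t], whose solution is [s]; each further stage consumes one universal word for the
    scenario and one existential word for the assignment. *)
Lemma recoverableP t pre (s : {set lit n}) : t <= size Xs -> size pre = 2 * t + 2 ->
  (forall l, solp x pre t (code l) = (l \in s)) ->
  recoverable (sat_solution cs) kap [seq scen X | X <- drop t Xs] s <->
  alternation false (2 * (size Xs - t)) B (playp x t (size Xs - t)) pre.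
Proof.
have [j ej] : exists j, size Xs - t = j by exists (size Xs - t).
rewrite ej; elim: j t ej pre s => [|j IH] t ej pre s le_t sz_pre pre_s.
  by rewrite drop_oversize; [split | lia].
have lt_t : t < size Xs by lia.
case eX: (drop t Xs) => [|X Xs'].
  by move/(congr1 size): eX; rewrite size_drop /=; lia.
have eXs' : drop t.+1 Xs = Xs' by rewrite -add1n -drop_drop eX /= drop0.
have [_ sigE] := stage_cons eX.
have [eX' _] := stage_at le_t; rewrite eX in eX'.
have -> : 2 * j.+1 = (2 * j).+2 by lia.
pose sol y1 y2 := [set l in decS X y1 | nth false y2 l.1 == l.2].
(* Once both words of stage [t.+1] are fixed, the rest of the game splits into the conditions on
   that stage and the game that starts from its solution. *)
have step y1 y2 : alternation false (2 * j) B (playp x t j.+1)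
    (rcons (rcons pre y1) y2) <->
  [/\ all (has (fun l : lit n => (l \in decS X y1) && (nth false y2 l.1 == l.2)))
      [seq tval C | C <- cs],
      #|symdiff s (sol y1 y2)| <= kap
    & recoverable (sat_solution cs) kap [seq scen X | X <- Xs'] (sol y1 y2)].
  set pre' := rcons _ _.
  have sz' : size pre' = 2 * t.+1 + 2 by rewrite !size_rcons sz_pre; lia.
  have nth1 : nth [::] pre' (2 * t.+1) = y1.
    rewrite nth_rcons nth_rcons size_rcons sz_pre.
    have -> : 2 * t.+1 = 2 * t + 2 by lia.
    by rewrite ltnSn ltnn eqxx.
  have nth2 : nth [::] pre' (2 * t.+1 + 1) = y2.
    rewrite nth_rcons size_rcons sz_pre.
    have -> : 2 * t.+1 + 1 = (2 * t + 2).+1 by lia.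
    by rewrite ltnn eqxx.
  have solE l : solp x pre' t.+1 (code l) =
      (l \in decS X y1) && (nth false y2 l.1 == l.2).
    by rewrite (@solpE (decS X y1)) ?nth2 // => l' /=; rewrite pnumE nth1 sigE.
  have solE' l : solp x pre' t.+1 (code l) = (l \in sol y1 y2).
    by rewrite solE inE.
  have solp0 : solp x pre' t = solp x pre t.
    apply: solp_eq; rewrite /pre' -!cats1 -catA takel_cat ?sz_pre //.
  pose a := satp x (solp x pre' t.+1) && distp x (solp x pre' t) (solp x pre' t.+1).
  have aE : a = all (has (fun l : lit n =>
      (l \in decS X y1) && (nth false y2 l.1 == l.2))) [seq tval C | C <- cs] &&
      (#|symdiff s (sol y1 y2)| <= kap).
    by rewrite /a (satpE solE) solp0 (distpE pre_s solE').
  rewrite -eXs'; have {}IH := IH t.+1 ltac:(lia) pre' (sol y1 y2) lt_t sz' solE'.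
  (* The conditions [a] depend only on words in [pre'], so they can be evaluated there and moved in
     front of the remaining quantifiers. *)
  have split_a : alternation false (2 * j) B (playp x t j.+1) pre' <->
      a /\ alternation false (2 * j) B (playp x t.+1 j) pre'.
    rewrite -alternation_and; apply: alternation_ext => ws sz_ws tk_ws.
    have e1 : solp x ws t.+1 = solp x pre' t.+1.
      by apply: solp_eq; rewrite -sz' tk_ws take_size.
    have e0 : solp x ws t = solp x pre' t.
      apply: solp_eq; have le2 : 2 * t + 2 <= size pre' by lia.
      by rewrite -tk_ws take_takel.
    rewrite /playp /= /a e0 e1.
    set p1 := satp _ _; set p2 := distp _ _ _; set p3 := all _ _; set p4 := all _ _.
    by split=> [/andP[/andP[-> ->] /andP[-> ->]]|[/andP[-> ->] /andP[-> ->]]].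
  rewrite split_a -IH aE; split=> [[/andP[h1 h2] h3]|[h1 h2 h3]] //.
  by split=> //; rewrite h1.
(* From left to right, every word [y1] codes a scenario. From right to left, every scenario has a
   code no longer than its encoding, which is part of the input and hence of length at most [B]. *)
rewrite /=; split=> [h y1 sy1|h sigma hsigma].
  have [s' [/sat_solutionP[y2 sy2 [sat es']] dist rec]] := h _ (dec_scen X y1).
  exists y2; first exact: leq_trans sy2 n_le_B.
  by apply/step; rewrite /sol -es'.
have [y1 sy1 ey1] := scen_dec hsigma.
have [|y2 sy2 /step[sat dist rec]] := h y1.
  apply: leq_trans sy1 (leq_trans _ B_ge).
  by move/(congr1 size): eX'; rewrite size_drop /= size_cat; lia.
exists (sol y1 y2); split=> //; rewrite -ey1.
exists (fun i => nth false y2 i) => //.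
move: sat; rewrite all_map; apply: sub_all => C /=.
rewrite !has_count count_filter => h'; apply: leq_trans h' _.
by apply: sub_count => l /=; rewrite andbC.
Qed.

Lemma gameP : HDRR (sat_solution cs) kap b [seq scen X | X <- Xs] <->
  alternation true (2 * size Xs).+1 B
    (fun ws => satp x (solp x ws 0) && playp x 0 (size Xs) ws) [:: x].
Proof.
have step y : alternation false (2 * size Xs) B
    (fun ws => satp x (solp x ws 0) && playp x 0 (size Xs) ws) [:: x; y] <->
  all (has (fun l : lit n => (l \in b) && (nth false y l.1 == l.2)))
      [seq tval C | C <- cs] /\
  recoverable (sat_solution cs) kap [seq scen X | X <- Xs]
    [set l in b | nth false y l.1 == l.2].
  have solE l : solp x [:: x; y] 0 (code l) = (l \in b) && (nth false y l.1 == l.2).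
    by rewrite (@solpE b) // => l' /=; rewrite nth_base.
  have := @recoverableP 0 [:: x; y] [set l in b | nth false y l.1 == l.2].
  rewrite drop0 subn0 => -> //; last by move=> l; rewrite solE inE.
  rewrite -(satpE solE) -alternation_and; apply: alternation_ext => ws _ tk.
  rewrite (@solp_eq x ws [:: x; y] 0) ?tk //.
  by split=> /andP.
split=> [[s0 /sat_solutionP[y sy [sat ->]] rec]|[y sy /step[sat rec]]].
  by exists y; [apply: leq_trans sy n_le_B | apply/step].
exists [set l in b | nth false y l.1 == l.2] => //.
exists (fun i => nth false y i) => //.
move: sat; rewrite all_map; apply: sub_all => C /=.
rewrite !has_count count_filter => h'; apply: leq_trans h' _.
by apply: sub_count => l /=; rewrite andbC.
Qed.

End Instance.

(** * Recognition of encodings *)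

Lemma pstage_ge x t : pkappa x <= pstage x t.
Proof.
elim: t => [|t IH] /=; last exact: leq_trans IH (nextp_ge _ _ _).
by rewrite /lend; lia.
Qed.

Lemma pstage_le x t j : t <= j -> pstage x t <= pstage x j.
Proof.
elim: j => [|j IH]; first by rewrite leqn0 => /eqP ->.
by rewrite leq_eqVlt => /predU1P[-> //|/IH h]; apply: leq_trans h (nextp_ge _ _ _).
Qed.

(** Proceeds backwards from the last stage, whose end is the end of the input; each round puts one
    scenario set in front of those already parsed. *)
Lemma stages_parse m x : pstage x m = size x ->
  all (fun t => okp x (pnum x) (pstage x t)) (iota 0 m) ->
  forall t, t <= m -> exists Xs : t.-tuple (S (pnum x)),
    drop (pstage x (m - t)) x = flatten [seq encS X | X <- Xs].
Proof.
move=> last_m ok; elim=> [|t IH] le_t.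
  by exists [tuple]; rewrite subn0 last_m drop_size.
have [Xs eXs] := IH (ltnW le_t).
have e : m - t = (m - t.+1).+1 by lia.
have [||X eX] := @S_parse (pnum x) x (pstage x (m - t.+1)).
- by rewrite -last_m -[nextp _ _ _]/(pstage x (m - t.+1).+1) pstage_le //; lia.
- by apply: (allP ok); rewrite mem_iota; lia.
by exists [tuple of X :: Xs]; rewrite eX -[nextp _ _ _]/(pstage x (m - t.+1).+1) -e eXs.
Qed.

Lemma clauses_parse x : clauses_ok x -> pbase x <= size x ->
  exists cs : seq (clause (pnum x)),
    drop (pclauses x) x = enc_list (@enc_clause _) cs ++ drop (pbase x) x.
Proof.
set n := pnum x => ok le_x; have [us [sz us_w e]] := list_parse le_x.
have [cs ecs] : exists cs, map (@enc_clause n) cs = us; last first.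
  by exists cs; rewrite enc_list_map ecs.
apply: map_surj => u /(nthP [::])[j lt_j eu].
have su : size u = 6 * n by apply/eqP/(allP us_w); rewrite -eu mem_nth.
have lit_at i : i < 3 -> exists l : lit n,
    take (2 * n) (drop (i * (2 * n)) u) = enc_set [set l].
  move=> lt_i; have [|A eA] := @enc_set_surj n (take (2 * n) (drop (i * (2 * n)) u)).
    by rewrite size_takel // size_drop su; nia.
  have /allP/(_ j) := ok; rewrite mem_iota /nclauses -sz => /(_ lt_j).
  move=> /allP/(_ i); rewrite mem_iota => /(_ lt_i).
  rewrite count_code.
  have -> : [set l : lit n | nth false x (pclause x j + (i * (2 * n) + code l))] = A.
    apply/setP => l; have lt_l := code_lt l.
    rewrite inE (list_item us_w e) //; last by nia.
    by rewrite eu -nth_enc_set eA nth_take // nth_drop.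
  by move=> /cards1P[l eAl]; exists l; rewrite -eA eAl.
have [[l0 e0] [l1 e1] [l2 e2]] := And3 (lit_at 0 isT) (lit_at 1 isT) (lit_at 2 isT).
exists [tuple l0; l1; l2]; rewrite /enc_clause /= -e0 -e1 -e2 cats0.
rewrite mul0n drop0 mul1n.
rewrite [take _ (drop (2 * (2 * n)) u)]take_oversize; last by rewrite size_drop su; lia.
have -> : drop (2 * (2 * n)) u = drop (2 * n) (drop (2 * n) u).
  by rewrite drop_drop; congr drop; lia.
by rewrite !cat_take_drop.
Qed.

Lemma layout_parse m x : layout_ok x m ->
  exists I : instance S m, x = enc_instance encS I.
Proof.
case/andP => /andP[/andP[ok_cl ok_kap] ok_st] /eqP last_m.
have le_st0 : pstage x 0 <= size x by rewrite -last_m pstage_le.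
have le_kap : pkappa x <= size x by apply: leq_trans (pstage_ge x m) _; rewrite last_m.
have le_base : pbase x <= size x by apply: leq_trans le_kap; rewrite leq_addr.
have le_cl : pclauses x <= size x.
  by apply: leq_trans le_base; rewrite /pbase /lend; lia.
have [us [sz us_0 e0]] := list_parse le_cl.
have eus : us = nseq (pnum x) [::].
  apply: (@eq_from_nth _ [::]) => [|i lt_i]; first by rewrite size_nseq sz.
  by rewrite nth_nseq if_same; apply/size0nil/eqP/(allP us_0)/mem_nth.
have [cs ecs] := clauses_parse ok_cl le_base.
have [b eb] := set_parse le_kap.
have [kap ekap] := nat_parse le_st0 ok_kap.
have [Xs eXs] := stages_parse last_m ok_st (leqnn m).
exists (Instance cs b kap Xs); rewrite /enc_instance /=.
rewrite -[LHS]drop0 e0 ecs eb ekap -[lend x _ 1]/(pstage x 0) -(subnn m) eXs.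
rewrite eus /enc_list -[LHS]catA; congr (_ ++ _).
by elim: (pnum x) => //= k ->.
Qed.

(** * The verifier runs in polynomial time *)

Section Complexity.

Variable m : nat.
(** The number of arguments of the matrix: the input and the [2 * m + 1] quantified words. *)
Let k := (2 * m + 1).+1.

Hypothesis rn_next : forall (C : ctx) (f g : C -> nat), rn k f -> rn k g ->
  rn k (fun c => nextp (nth [::] (wds c) 0) (f c) (g c)).
Hypothesis rb_ok : forall (C : ctx) (f g : C -> nat), rn k f -> rn k g ->
  rb k (fun c => okp (nth [::] (wds c) 0) (f c) (g c)).
Hypothesis rb_sig : forall (C : ctx) j (f g q : C -> nat), j < k ->
  rn k f -> rn k g -> rn k q ->
  rb k (fun c => sigp (nth [::] (wds c) 0) (f c) (g c) (nth [::] (wds c) j) (q c)).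

Notation input c := (nth [::] (wds c) 0).

Lemma rn_pnum (C : ctx) : rn k (fun c : C => pnum (input c)).
Proof. by apply: rn_llen => //; apply: rn_const. Qed.

Lemma rn_pclauses (C : ctx) : rn k (fun c : C => pclauses (input c)).
Proof. by apply: rn_lend => //; apply: rn_const. Qed.

Lemma rn_nclauses (C : ctx) : rn k (fun c : C => nclauses (input c)).
Proof.
apply: rn_llen => //; first exact: rn_pclauses.
by apply: rn_mul; [apply: rn_const | apply: rn_pnum].
Qed.

Lemma rn_pbase (C : ctx) : rn k (fun c : C => pbase (input c)).
Proof.
apply: rn_lend => //; first exact: rn_pclauses.
by apply: rn_mul; [apply: rn_const | apply: rn_pnum].
Qed.

Lemma rn_pkappa (C : ctx) : rn k (fun c : C => pkappa (input c)).
Proof.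
apply: rn_add; first exact: rn_pbase.
by apply: rn_mul; [apply: rn_const | apply: rn_pnum].
Qed.

(** The stage number is fixed outside the program, so its recursion becomes a nesting of [t]
    programs; the machine and its time bound may depend on [m]. *)
Lemma rn_pstage (C : ctx) t : rn k (fun c : C => pstage (input c) t).
Proof.
elim: t => [|t IH] /=; last exact: rn_next (rn_pnum C) IH.
by apply: rn_lend => //; [apply: rn_pkappa | apply: rn_const].
Qed.

Ltac rn_layout := repeat first
  [ exact: rn_pnum | exact: rn_pclauses | exact: rn_nclauses | exact: rn_pbase
  | exact: rn_pkappa | exact: rn_pstage | rn_step ].

Lemma rb_bit_clause (C : ctx) (j i q : C -> nat) : rn k j -> rn k i -> rn k q ->
  rb k (fun c => nth false (input c)
    (pclause (input c) (j c) + (i c * (2 * pnum (input c)) + q c))).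
Proof. by move=> rj ri rq; rewrite /pclause; rn_layout. Qed.

Lemma rb_solp (C : ctx) t (q : C -> nat) : t <= m -> rn k q ->
  rb k (fun c => solp (input c) (wds c) t (q c)).
Proof.
move=> le_t rq; apply: rb_and.
  case: t le_t => [|t] le_t; first by rewrite /active; rn_layout.
  apply: rb_sig => //; first by rewrite /k; lia.
    exact: rn_pnum.
  exact: rn_pstage.
apply: rb_eqb; last by rn_layout.
by apply: rb_bit; [rewrite /k; lia | apply: rn_half].
Qed.

Lemma rb_satp (C : ctx) t : t <= m ->
  rb k (fun c : C => satp (input c) (solp (input c) (wds c) t)).
Proof.
move=> le_t; rewrite /satp.
do 3!(first [apply: rb_all | apply: rb_has]; first by rn_layout).
apply: rb_and; first by apply: rb_bit_clause; rn_layout.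
by apply: (@rb_solp _ t); [exact: le_t | rn_layout].
Qed.

Lemma rb_distp (C : ctx) t : t < m ->
  rb k (fun c : C => distp (input c) (solp (input c) (wds c) t)
                                     (solp (input c) (wds c) t.+1)).
Proof.
move=> lt_t; apply: rb_leq; last by apply: rn_nval => //; apply: rn_pkappa.
apply: rn_count; first by rn_layout.
by apply/rb_neg/rb_eqb; apply: rb_solp; rn_layout; apply: ltnW.
Qed.

Lemma rb_layout_ok (C : ctx) : rb k (fun c : C => layout_ok (input c) m).
Proof.
apply: rb_and; last by rn_layout.
apply: rb_and; last first.
  apply: (@rb_allm k C (fun t c => okp (input c) (pnum (input c)) (pstage (input c) t))).
  by move=> t _; apply: rb_ok; rn_layout.
apply: rb_and; last by apply: rb_natok => //; apply: rn_pkappa.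
rewrite /clauses_ok.
do 2!(apply: rb_all; first by rn_layout).
apply: rb_eqn; last exact: rn_const.
apply: rn_count; first by rn_layout.
by apply: rb_bit_clause; rn_layout.
Qed.

Definition verifier (ws : seq word) : bool :=
  let x := nth [::] ws 0 in
  layout_ok x m && (satp x (solp x ws 0) && playp x 0 m ws).

Lemma rb_verifier : rb k (C := inputs) verifier.
Proof.
apply: rb_and; first exact: rb_layout_ok.
apply: rb_and; first exact: rb_satp.
apply: rb_and.
  apply: (@rb_allm k inputs (fun t c => satp (input c) (solp (input c) (wds c) t))).
  by move=> t; rewrite mem_iota => ht; apply: rb_satp; lia.
apply: (@rb_allm k inputs (fun t c => distp (input c) (solp (input c) (wds c) t)
  (solp (input c) (wds c) t.+1))).
by move=> t; rewrite mem_iota => ht; apply: rb_distp; lia.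
Qed.

Lemma SigmaP_verifier (L : language) :
  (forall x, L x <-> exists I : instance S m,
     [/\ x = enc_instance encS I, all (@wfS _) (stages I) & robust_3sat scen I]) ->
  SigmaP (2 * m + 1) L.
Proof.
move=> hL; exists verifier; first exact: ptime_rn rb_verifier.
(* These constants make the bound on the quantified words [size x + 1], and codes of length at most
   [size x] suffice. *)
exists 1, 1 => x; set B := poly_bound _ _ _.
have B_ge : size x <= B by rewrite /B /poly_bound expn1; lia.
have -> : alternation true (2 * m + 1) B verifier [:: x] <->
    layout_ok x m /\ alternation true (2 * m + 1) B
      (fun ws => satp x (solp x ws 0) && playp x 0 m ws) [:: x].
  rewrite -alternation_and; apply: alternation_ext => -[|y ws] //= _ [->].
  by split=> /andP.
rewrite hL addn1; split=> [[I [ex wf rob]]|[ok alt]].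
  case: I ex wf rob => n cs b kap Xs /= ex wf rob; rewrite -(size_tuple Xs).
  by rewrite (layout_okE ex) wf; split=> //; apply/(gameP ex B_ge).
have [I ex] := layout_parse ok; exists I.
case: I ex => n cs b kap Xs /= ex; split=> //.
  by rewrite -(layout_okE ex) size_tuple.
by apply/(gameP ex B_ge); rewrite size_tuple.
Qed.

End Complexity.
End Verifier.

(** * Polynomial-time reading of the two kinds of scenario sets *)

Section KindComplexity.

Variable k : nat.
Hypothesis k_gt0 : 0 < k.

Notation input c := (nth [::] (wds c) 0).

Lemma rn_xor_next (C : ctx) (f g : C -> nat) : rn k f -> rn k g ->
  rn k (fun c => xor_next (input c) (f c) (g c)).
Proof. by move=> rf rg; apply: rn_lend => //; rn_tac. Qed.

Lemma rb_xor_ok (C : ctx) (f g : C -> nat) : rn k f -> rn k g ->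
  rb k (fun c => xor_ok (input c) (f c) (g c)).
Proof.
move=> rf rg.
have rl : rn k (fun c => xor_len (input c) (f c) (g c)).
  by apply: rn_llen => //; rn_tac.
by rewrite /xor_ok /xor_pos; rn_tac.
Qed.

Lemma rb_xor_sig (C : ctx) j (f g q : C -> nat) : j < k ->
  rn k f -> rn k g -> rn k q ->
  rb k (fun c => xor_sig (input c) (f c) (g c) (nth [::] (wds c) j) (q c)).
Proof.
move=> lt_j rf rg rq.
have rl : rn k (fun c => xor_len (input c) (f c) (g c)).
  by apply: rn_llen => //; rn_tac.
by rewrite /xor_sig /xor_pos; rn_tac.
Qed.

Lemma rn_gamma_mid (C : ctx) (f g : C -> nat) : rn k f -> rn k g ->
  rn k (fun c => gamma_mid (input c) (f c) (g c)).
Proof. by move=> rf rg; apply: rn_lend => //; rn_tac. Qed.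

Lemma rn_gamma_next (C : ctx) (f g : C -> nat) : rn k f -> rn k g ->
  rn k (fun c => gamma_next (input c) (f c) (g c)).
Proof.
move=> rf rg; apply: rn_lend => //; [exact: rn_gamma_mid | exact: rn_const].
Qed.

Lemma rb_gamma_sig (C : ctx) j (f g q : C -> nat) : j < k ->
  rn k f -> rn k g -> rn k q ->
  rb k (fun c => gamma_sig (input c) (f c) (g c) (nth [::] (wds c) j) (q c)).
Proof.
move=> lt_j rf rg rq.
have rl : rn k (fun c => gamma_len (input c) (f c) (g c)).
  by apply: rn_llen => //; rn_tac.
have rv : rn k (fun c => nval (input c) (gamma_mid (input c) (f c) (g c))).
  by apply: rn_nval => //; apply: rn_gamma_mid.
by rewrite /gamma_sig /gamma_pos; rn_tac.
Qed.

End KindComplexity.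

Lemma xor_next_ge x n p : p <= xor_next x n p.
Proof. by rewrite /xor_next /lend; lia. Qed.

Lemma gamma_next_ge x n p : p <= gamma_next x n p.
Proof. by rewrite /gamma_next /gamma_mid /lend; lia. Qed.

(** Each pair costs at least its list flag in the input; with [1 <= c] this gives the required
    linear bound. *)
Lemma size_xor_pairs_enc m (I : instance xor_set m) :
  all (fun X => size (xor_pairs X) <= size (enc_instance enc_xor I)) (stages I).
Proof.
apply: (@sub_all _ (fun X => size (xor_pairs X) <=
    size (flatten [seq enc_xor X | X <- stages I]))).
  by move=> X /leq_trans; apply; rewrite size_cat /= !size_cat; lia.
elim: (tval (stages I)) => //= X s IH; rewrite size_cat.
apply/andP; split; last by apply: sub_all IH => Y; lia.
apply: leq_trans (leq_addr _ _); rewrite size_cat.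
exact: leq_trans (size_enc_list_ge _ _) (leq_addl _ _).
Qed.

Theorem theorem20 (m c : nat) (hc : 0 < c) :
  SigmaP (2 * m + 1) (HDRR_3SAT_xor m c) /\
  SigmaP (2 * m + 1) (HDRR_3SAT_gamma m).
Proof.
split.
  apply: (@SigmaP_verifier xor_set xor_scenario enc_xor xor_wf xor_dec
    xor_next xor_ok xor_sig) => //.
  - exact: xor_dec_scenario.
  - exact: xor_scenario_dec.
  - exact: xor_at.
  - by move=> n x p le_x _; apply: xor_parse.
  - exact: xor_next_ge.
  - by move=> *; apply: rn_xor_next.
  - by move=> *; apply: rb_xor_ok.
  - by move=> *; apply: rb_xor_sig.
  move=> x; split=> [[I [ex wf _ rob]]|[I [ex wf rob]]]; exists I; split=> //.
  apply: sub_all (size_xor_pairs_enc I) => X /leq_trans; apply.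
  by rewrite ex leq_pmull.
(* Every list of sets is admissible, so [wfS] is constantly true, while [okp] still verifies that
   the bound is written in canonical binary. *)
apply: (@SigmaP_verifier gamma_set gamma_scenario enc_gamma (fun _ _ => true)
  gamma_dec gamma_next (fun x n p => natok x (gamma_mid x n p)) gamma_sig) => //.
- exact: gamma_dec_scenario.
- exact: gamma_scenario_dec.
- exact: gamma_at.
- exact: gamma_parse.
- exact: gamma_next_ge.
- by move=> *; apply: rn_gamma_next.
- by move=> *; apply: rb_natok => //; apply: rn_gamma_mid.
- by move=> *; apply: rb_gamma_sig.
move=> x; split=> [[I ex rob]|[I [ex _ rob]]]; exists I => //.
by split=> //; apply/all_predT.
Qed.
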